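(* Let $K$ be a field and let $T$ be a stretched forest with at least one edge. Let $I(T)$ be its edge ideal in the polynomial ring $R=K[V]$, where $V$ is the vertex set of $T$. Then $\mathrm{pd}\,I(T)=\mathrm{ara}\,I(T)$, and there is a tree-like system of length $\mathrm{ara}\,I(T)$ whose support is the set of edge monomials of $T$.
   Context: Graphs are finite and simple; a forest is an acyclic graph. The vertices of a graph $G$ are taken as the indeterminates of the polynomial ring $R=K[V]$ over the field $K$. For an edge $\{u,v\}$ of $G$, the monomial $uv\in R$ is called its edge monomial, and the edge ideal $I(G)$ is the ideal of $R$ generated by the edge monomials of all edges of $G$. A forest is called stretched if every edge of it has (at least) one vertex of degree at most 2. For an ideal $I$ of $R$: the arithmetical rank $\mathrm{ara}\,I$ is the least number of elements of $R$ which generate $I$ up to radical, i.e. the least $t$ for which there are $q_1,\dots,q_t\in R$ with $\sqrt{(q_1,\dots,q_t)}=\sqrt{I}$. The notation $\mathrm{pd}\,I$ denotes, by convention, the length of every minimal free resolution of the quotient $R/I$ over $R$. Tree-like system: let $a_0,a_1,\dots,a_r\in R$ be non zero pairwise distinct elements and let $b_1,\dots,b_r\in R$ be such that the non zero $b_i$'s are pairwise distinct and also distinct from the $a_i$'s. Set $q_0=a_0$ and $q_i=a_i+b_i$ for $i=1,\dots,r$. Suppose that for all $i=1,\dots,r$ there is an index $j<i$ such that $a_j$ divides $a_ib_i$. Then the sequence $\Sigma: q_0,q_1,\dots,q_r$ (together with the chosen summands) is called a tree-like system. Its length is $r+1$, and its support is the set of all $a_i$'s and all non zero $b_i$'s.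 *)

(* Defs.v *)
From HB Require Import structures.
From mathcomp Require Import all_boot all_order all_algebra.
From mathcomp Require Import mpoly.

Set Implicit Arguments.
Unset Strict Implicit.
Unset Printing Implicit Defensive.

Import GRing.Theory.
Local Open Scope ring_scope.

Definition degree (V : finType) (e : rel V) (v : V) : nat := #|[set w | e v w]|.

(* Meant for a symmetric irreflexive [e]: then [u; v] is a [ucycle] as soon as
   uv is an edge, so that the cycles of the graph are those of size >= 3. *)
Definition forest (V : finType) (e : rel V) : Prop :=
  forall c : seq V, ucycle e c -> (size c <= 2)%N.

Definition stretched (V : finType) (e : rel V) : Prop :=
  forall u v : V, e u v -> (degree e u <= 2)%N || (degree e v <= 2)%N.

Section Ideals.
Variable R : comNzRingType.
Implicit Types S I : R -> Prop.

Definition ideal_gen S : R -> Prop := fun f =>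
  exists (k : nat) (c s : 'I_k -> R),
    (forall i, S (s i)) /\ f = \sum_(i < k) c i * s i.

Definition radical I : R -> Prop := fun f => exists k : nat, I (f ^+ k).

Definition generates_up_to_radical (t : nat) (q : 'I_t -> R) I : Prop :=
  forall f : R,
    radical (ideal_gen (fun g => exists i, g = q i)) f <-> radical I f.

Definition is_ara I (t : nat) : Prop :=
  (exists q : 'I_t -> R, generates_up_to_radical q I) /\
  (forall (s : nat) (q : 'I_s -> R),
     generates_up_to_radical q I -> (t <= s)%N).

Definition divides (f g : R) : Prop := exists c : R, g = c * f.

(* [b i] stands for b_(i+1), the partner of a_(i+1) = [a (lift ord0 i)]. *)
Definition tree_like_system (r : nat) (q a : 'I_r.+1 -> R) (b : 'I_r -> R) :
    Prop :=
  [/\ (forall i, a i != 0) /\ injective a,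
      (forall i j, b i != 0 -> b i = b j -> i = j),
      (forall i j, b i != 0 -> b i != a j),
      q ord0 = a ord0 /\
        (forall i : 'I_r, q (lift ord0 i) = a (lift ord0 i) + b i)
    & forall i : 'I_r, exists j : 'I_r.+1,
        (j < lift ord0 i)%N /\ divides (a j) (a (lift ord0 i) * b i)].

Definition tree_like_support (r : nat) (a : 'I_r.+1 -> R) (b : 'I_r -> R) :
    R -> Prop := fun f =>
  (exists i, f = a i) \/ (exists i, b i != 0 /\ f = b i).

End Ideals.

Section EdgeIdeal.
Variables (K : fieldType) (V : finType).

(* K[V]: the vertex v is the indeterminate of index [enum_rank v]. *)
Definition vertex_ring := {mpoly K[#|V|]}.

Definition vertex_var (v : V) : vertex_ring := 'X_(enum_rank v).

Definition edge_monomial (e : rel V) : vertex_ring -> Prop := fun f =>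
  exists u v : V, e u v /\ f = vertex_var u * vertex_var v.

Definition edge_ideal (e : rel V) : vertex_ring -> Prop :=
  ideal_gen (edge_monomial e).

End EdgeIdeal.

Section Resolutions.
Variables (K : fieldType) (n : nat).
Local Notation R := {mpoly K[n]}.

(* A sequence ... -> F_1 -> F_0 -> R of graded free modules of finite rank
   and linear maps between them, F_i having a basis of size [rk i] whose
   element u has degree [sh u].  Vectors are rows and maps act by
   multiplication on the right.  [aug] lifts the augmentation F_0 -> R / I;
   such a lift always exists, as F_0 is free. *)
Record graded_sequence := GradedSequence {
  rk : nat -> nat;
  sh : forall i, 'I_(rk i) -> int;
  aug : 'cV[R]_(rk 0);
  dif : forall i, 'M[R]_(rk i.+1, rk i)
}.

(* Every map is homogeneous of degree 0. *)
Definition homogeneous_maps (F : graded_sequence) : Prop :=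
  (forall (u : 'I_(rk F 0)) (j : 'I_1) (m : 'X_{1..n}),
     m \in msupp (aug F u j) -> (mdeg m)%:Z = sh u) /\
  (forall (i : nat) (u : 'I_(rk F i.+1)) (v : 'I_(rk F i)) (m : 'X_{1..n}),
     m \in msupp (dif F i u v) -> (mdeg m)%:Z + sh v = sh u).

(* Exactness of ... -> F_1 -> F_0 -> R / I -> 0. *)
Definition resolves_quotient (I : R -> Prop) (F : graded_sequence) : Prop :=
  [/\ (forall f : R, exists v : 'rV[R]_(rk F 0),
         I (f - (v *m aug F) ord0 ord0)),
      (forall v : 'rV[R]_(rk F 0),
         I ((v *m aug F) ord0 ord0) <->
         exists w : 'rV[R]_(rk F 1), v = w *m dif F 0)
    & (forall (i : nat) (v : 'rV[R]_(rk F i.+1)),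
         v *m dif F i = 0 <->
         exists w : 'rV[R]_(rk F i.+2), v = w *m dif F i.+1)].

(* The image of each F_(i+1) lies in m F_i, for m the ideal generated by the
   indeterminates. *)
Definition minimal_maps (F : graded_sequence) : Prop :=
  forall (i : nat) (u : 'I_(rk F i.+1)) (v : 'I_(rk F i)),
    (dif F i u v)@_0%MM = 0.

Definition minimal_free_resolution (I : R -> Prop) (F : graded_sequence) :
    Prop :=
  [/\ homogeneous_maps F, resolves_quotient I F & minimal_maps F].

Definition has_length (F : graded_sequence) (p : nat) : Prop :=
  (0 < rk F p)%N /\ (forall i, (p < i)%N -> rk F i = 0%N).

(* pd I is, by convention, the projective dimension of R / I. *)
Definition is_pd (I : R -> Prop) (p : nat) : Prop :=
  (exists F : graded_sequence, minimal_free_resolution I F) /\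
  (forall F : graded_sequence, minimal_free_resolution I F -> has_length F p).

End Resolutions.

(* Main.v *)
Require Import Defs.
From mathcomp Require Import all_boot all_order all_algebra mpoly.
From mathcomp Require Import zify ring.

(** Why the theorem holds.  For a vertex cover [C] that is minimal, the ideal
    generated by the variables in [C] is a minimal prime of the edge ideal, so
    its height [#|C|] is a lower bound for the arithmetical rank.  Write [t]
    for the largest size of a minimal vertex cover; it is convenient to speak
    of the complements, which are the maximal independent sets.  Three facts
    make all the invariants equal to [t].

    - The projective dimension is [t] for every forest ([forest_resolution]).
      If [x] is a leaf attached to [y], then I(S) = I(S - x) + (xy), and the
      colon ideal I(S - x) : xy = I(S - x) : y is generated by I(S - N[y]) and
      by the variables in N(y) - x.  A comparison map lifting multiplication by
      [y] between resolutions of the two quotients, multiplied by the variable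
      [x], lifts multiplication by [xy], and all its entries lie in the maximal
      ideal, so that its mapping cone is again minimal
      ([has_resolution_cone]).  Hence the length of the resolution of S is the
      maximum of that for S - x and of #|N(y)| plus that for S - N[y]; the
      largest size of a minimal cover satisfies the same recursion.  Minimal
      resolutions have unique ranks ([minimal_rank_le]), which turns the
      resolution so built into the value of the projective dimension.

    - At least #|C| elements are needed to generate the edge ideal up to
      radical ([cover_le_generators]).  Setting the variables outside of [C]
      to 1 maps such elements to polynomials in the variables of [C] that
      vanish at the origin and generate up to radical the maximal ideal there;
      counting dimensions shows that there are at least as many of them as
      variables ([parameters_ge]).

    - A stretched forest has a tree-like system on its edges whose length is
      the size of some minimal cover ([stretched_forest_chain]); and a
      tree-like system generates up to radical the ideal of its support
      ([tree_like_radical]).  The system and the independent set are built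
      together, around a vertex [z] all of whose neighbours, but at most one,
      are leaves or carry a single pendant leaf ([exists_centre],
      [centre_chain]).

    So the length of the system is the size of a minimal cover, hence at most
    the projective dimension; the projective dimension is the size of a minimal
    cover, hence at most the number of elements of any set generating the ideal
    up to radical; and the system is such a set. *)

Set Implicit Arguments.
Unset Strict Implicit.
Unset Printing Implicit Defensive.

Import Order.TTheory GRing.Theory.
Local Open Scope ring_scope.

(** * Monomial ideals *)

Section MonomialIdeals.
Variables (K : fieldType) (n : nat).
Local Notation R := {mpoly K[n]}.
Implicit Types (P : pred 'X_{1..n}) (f g c : R) (m : 'X_{1..n}).

Definition upset P := forall m k, P m -> P (m + k)%MM.

(** The ideal spanned by the monomials in [P], when [P] is an upset. Membership
    is decidable, and colons by monomials are translations of [P]. *)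
Definition monomial_ideal P f : bool := all P (msupp f).

Lemma monomial_ideal0 P : monomial_ideal P 0.
Proof. by rewrite /monomial_ideal msupp0. Qed.

Lemma monomial_idealD P f g :
  monomial_ideal P f -> monomial_ideal P g -> monomial_ideal P (f + g).
Proof.
move=> /allP Pf /allP Pg; apply/allP => m /msuppD_le.
by rewrite mem_cat => /orP[/Pf|/Pg].
Qed.

Lemma monomial_idealN P f : monomial_ideal P (- f) = monomial_ideal P f.
Proof. by apply: perm_all; apply: msuppN. Qed.

Lemma monomial_idealB P f g :
  monomial_ideal P f -> monomial_ideal P g -> monomial_ideal P (f - g).
Proof. by move=> Pf Pg; apply: monomial_idealD; rewrite ?monomial_idealN. Qed.

Lemma monomial_ideal_sum P (I : Type) (r : seq I) (Q : pred I) (F : I -> R) :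
  (forall i, Q i -> monomial_ideal P (F i)) ->
  monomial_ideal P (\sum_(i <- r | Q i) F i).
Proof.
move=> PF; apply: (big_ind (fun f => is_true (monomial_ideal P f))) => //.
- exact: monomial_ideal0.
- by move=> f g; apply: monomial_idealD.
Qed.

Lemma monomial_idealMl P c f :
  upset P -> monomial_ideal P f -> monomial_ideal P (c * f).
Proof.
move=> up /allP Pf; apply/allP => m /msuppM_le /allpairsP[[m1 m2] /=].
by case=> _ /Pf Pm2 ->; rewrite addmC; apply: up.
Qed.

Lemma monomial_idealZX P a m : P m -> monomial_ideal P (a *: 'X_[m]).
Proof.
by move=> Pm; apply/allP => k /msuppZ_le; rewrite msuppX inE => /eqP->.
Qed.

Lemma monomial_idealMX P f m :
  monomial_ideal P ('X_[m] * f) = monomial_ideal (fun k => P (m + k)%MM) f.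
Proof.
rewrite /monomial_ideal mulrC (perm_all _ (msuppMX f m)) all_map.
by apply: eq_all => k /=.
Qed.

Lemma eq_monomial_ideal P (Q : pred _) f :
  P =1 Q -> monomial_ideal P f = monomial_ideal Q f.
Proof. by move=> PQ; apply: eq_all. Qed.

Lemma sub_monomial_ideal P (Q : pred _) f :
  (forall m, P m -> Q m) -> monomial_ideal P f -> monomial_ideal Q f.
Proof. by move=> PQ /allP Pf; apply/allP => m /Pf /PQ. Qed.

(** Splitting [f] according to [P]: the terms outside of [P] are multiples of
    the extra generator. *)
Lemma monomial_ideal_addX P m f :
  monomial_ideal (fun k => P k || (m <= k)%MM) f ->
  exists c, monomial_ideal P (f - c * 'X_[m]).
Proof.
move=> /allP Pf.
exists (\sum_(k <- msupp f | ~~ P k) f@_k *: 'X_[k - m]).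
rewrite {1}[f]mpolyE (bigID P) /= mulr_suml -addrA -sumrB.
rewrite [X in _ + X]big_seq_cond [X in _ + X]big1 => [|k /andP[kf nPk]];
  last first.
  have := Pf _ kf; rewrite (negPf nPk) /= => mk.
  by rewrite -scalerAl -mpolyXD submK // subrr.
by rewrite addr0; apply: monomial_ideal_sum => k; apply: monomial_idealZX.
Qed.

End MonomialIdeals.

(** * Minimal resolutions and their uniqueness *)

Section Resolutions.
Variables (K : fieldType) (n : nat).
Local Notation R := {mpoly K[n]}.
Local Notation ideal_of P := (fun f : R => is_true (monomial_ideal P f)).
Implicit Types (I : R -> Prop) (F G : graded_sequence K n).

Lemma rows_mulmx k l m (A : 'M[R]_(k, m)) (B : 'M[R]_(l, m)) :
  (forall i, exists w, row i A = w *m B) -> exists W, A = W *m B.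
Proof.
move=> /fin_all_exists[w Aw]; exists (\matrix_i w i).
by apply/row_matrixP => i; rewrite Aw row_mul rowK.
Qed.

Lemma row_mulmxE k l m (A : 'M[R]_(k, l)) (B : 'M[R]_(l, m)) i j :
  (row i A *m B) ord0 j = (A *m B) i j.
Proof. by rewrite -row_mul [LHS]mxE. Qed.

Lemma exact_dif I F i k (A : 'M[R]_(k, rk F i.+1)) :
  resolves_quotient I F -> A *m dif F i = 0 ->
  exists W, A = W *m dif F i.+1.
Proof.
case=> _ _ ex A0; apply: rows_mulmx => j; apply/ex.
by rewrite -row_mul A0 row0.
Qed.

Lemma exact_aug I F k (A : 'M[R]_(k, rk F 0)) :
  resolves_quotient I F -> (forall j, I ((A *m aug F) j ord0)) ->
  exists W, A = W *m dif F 0.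
Proof.
case=> _ ex _ AI; apply: rows_mulmx => j; apply/ex.
by rewrite row_mulmxE.
Qed.

Lemma dif_dif I F i : resolves_quotient I F -> dif F i.+1 *m dif F i = 0.
Proof.
case=> _ _ ex; apply/row_matrixP => j; rewrite row_mul row0.
by apply/ex; exists (delta_mx ord0 j); rewrite rowE.
Qed.

Lemma dif_aug I F j :
  resolves_quotient I F -> I ((dif F 0 *m aug F) j ord0).
Proof.
case=> _ ex _.
rewrite -row_mulmxE.
by apply/ex; exists (delta_mx ord0 j); rewrite rowE.
Qed.

Lemma eq_minimal_free_resolution I I' F :
  (forall f, I f <-> I' f) ->
  minimal_free_resolution I F -> minimal_free_resolution I' F.
Proof.
move=> II' [hF [sF eF xF] mF]; split=> //; split=> // [f|v].
  by have [v fv] := sF f; exists v; apply/II'.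
by split=> [/II'/eF|/eF/II'].
Qed.

(** The comparison theorem, for resolutions of the quotients by two ideals such
    that multiplication by [g] maps one quotient to the other. *)
Section Comparison.
Variables (P Q : pred 'X_{1..n}) (g : R) (F G : graded_sequence K n).
Hypotheses (upP : upset P).
Hypothesis gQP : forall f, monomial_ideal Q f -> monomial_ideal P (g * f).
Hypothesis resF : resolves_quotient (ideal_of P) F.
Hypothesis resG : resolves_quotient (ideal_of Q) G.

Let liftable i (phi : 'M[R]_(rk G i, rk F i)) :=
  exists psi, dif G i *m phi = psi *m dif F i.

(* One step of the lifting; equality of matrices being decidable, the choice
   operator of the polynomial ring turns the existence of a lift into a
   function, which can then be iterated. *)
Let next i (phi : {phi | @liftable i phi}) :
  {psi : {psi | @liftable i.+1 psi} |
     sval psi *m dif F i == dif G i *m sval phi}.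
Proof.
case: phi => phi /= phiP.
have [psi /eqP psiE] : {psi | dif G i *m phi == psi *m dif F i}.
  by apply: sigW; case: phiP => psi ->; exists psi.
have psiP : @liftable i.+1 psi.
  apply: exact_dif resF _.
  by rewrite -mulmxA -psiE mulmxA (dif_dif _ resG) mul0mx.
by exists (exist _ psi psiP) => /=; rewrite psiE.
Qed.

Lemma comparison : exists phi : forall i, 'M[R]_(rk G i, rk F i),
  (forall u, monomial_ideal P (g * aug G u ord0 - (phi 0 *m aug F) u ord0)) /\
  (forall i, phi i.+1 *m dif F i = dif G i *m phi i).
Proof.
have /fin_all_exists[w wP] u : exists w : 'rV[R]_(rk F 0),
    monomial_ideal P (g * aug G u ord0 - (w *m aug F) ord0 ord0).
  by case: resF.
pose phi0 : 'M[R]_(rk G 0, rk F 0) := \matrix_u w u.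
have phi0P u : monomial_ideal P (g * aug G u ord0 - (phi0 *m aug F) u ord0).
  by rewrite -row_mulmxE rowK; apply: wP.
have lift0 : @liftable 0 phi0.
  apply: exact_aug resF _ => j; rewrite -mulmxA.
  have -> : (dif G 0 *m (phi0 *m aug F)) j ord0 =
      g * (dif G 0 *m aug G) j ord0 -
      \sum_u dif G 0 j u * (g * aug G u ord0 - (phi0 *m aug F) u ord0).
    rewrite !mxE mulr_sumr -sumrB; apply: eq_bigr => u _.
    by rewrite mulrBr mulrCA opprB addrC subrK.
  apply: monomial_idealB; first by apply/gQP/(dif_aug _ resG).
  by apply: monomial_ideal_sum => u _; apply: monomial_idealMl.
pose s := nat_rect (fun i => {phi | @liftable i phi}) (exist _ phi0 lift0)
  (fun i phi => sval (next phi)).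
exists (fun i => sval (s i)); split=> // i.
exact/eqP/(svalP (next (s i))).
Qed.

End Comparison.

Lemma mcoeff0_mulmx k l m (A : 'M[R]_(k, l)) (B : 'M[R]_(l, m)) :
  (forall i j, (B i j)@_0%MM = 0) -> forall i j, ((A *m B) i j)@_0%MM = 0.
Proof.
move=> B0 i j; rewrite mxE raddf_sum big1 // => u _ /=.
by rewrite (rmorphM (mcoeff 0%MM)) /= B0 mulr0.
Qed.

Lemma mcoeff0_mulmxl k l m (A : 'M[R]_(k, l)) (B : 'M[R]_(l, m)) :
  (forall i j, (A i j)@_0%MM = 0) -> forall i j, ((A *m B) i j)@_0%MM = 0.
Proof.
move=> A0 i j; rewrite mxE raddf_sum big1 // => u _ /=.
by rewrite (rmorphM (mcoeff 0%MM)) /= A0 mul0r.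
Qed.

(** A chain endomorphism inducing 0 on the quotient is null-homotopic, hence,
    the differentials being minimal, 0 modulo the maximal ideal. Only one step
    [h] of the homotopy is kept at each stage of the induction. *)
Lemma null_chain_map P F (psi : forall i, 'M[R]_(rk F i)) :
  resolves_quotient (ideal_of P) F -> minimal_maps F ->
  (forall u, monomial_ideal P ((psi 0%N *m aug F) u ord0)) ->
  (forall i, psi i.+1 *m dif F i = dif F i *m psi i) ->
  forall i u v, (psi i u v)@_0%MM = 0.
Proof.
move=> resF minF psi0 psiS i.
have [h [hd h0]] : exists h, dif F i *m (psi i - h *m dif F i) = 0 /\
    forall u v, ((psi i - h *m dif F i) u v)@_0%MM = 0.
  elim: i => [|i [h [hd h0]]].
    have [h ->] := exact_aug resF psi0.
    by exists h; rewrite subrr mulmx0; split=> // u v; rewrite mxE mcoeff0.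
  have [k psik] : exists k, psi i.+1 - dif F i *m h = k *m dif F i.+1.
    apply: exact_dif resF _; rewrite mulmxBl psiS -mulmxA -mulmxBr.
    exact: hd.
  exists k; rewrite -psik opprB addrC subrK mulmxA (dif_dif _ resF) mul0mx.
  by split=> //; apply/mcoeff0_mulmxl/minF.
move=> u v; rewrite -[psi i](subrK (h *m dif F i)) mxE mcoeffD h0.
by rewrite mcoeff0_mulmx ?addr0 //; apply: minF.
Qed.

(** The composition of two comparison maps lifts the identity, so it is the
    identity modulo the maximal ideal: over the field, the identity matrix of
    size [rk F i] factors through dimension [rk G i]. *)
Lemma minimal_rank_le P F G i : upset P ->
  minimal_free_resolution (ideal_of P) F ->
  minimal_free_resolution (ideal_of P) G -> (rk F i <= rk G i)%N.
Proof.
move=> upP [_ resF minF] [_ resG _].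
have mul1P (f : R) : monomial_ideal P f ->
  monomial_ideal P (1 * f) by rewrite mul1r.
have [phi [phi0 phiS]] := comparison upP mul1P resG resF.
have [psi [psi0 psiS]] := comparison upP mul1P resF resG.
have null : forall u v, ((phi i *m psi i - 1%:M) u v)@_0%MM = 0.
  move: i; apply: (null_chain_map resF minF) => [u|i]; last first.
    by rewrite mulmxBl mulmxBr mul1mx mulmx1 -mulmxA psiS !mulmxA phiS.
  have -> : ((phi 0 *m psi 0 - 1%:M) *m aug F) u ord0 =
      - ((1 * aug F u ord0 - (phi 0 *m aug G) u ord0) +
         \sum_v phi 0 u v * (1 * aug G v ord0 - (psi 0 *m aug F) v ord0)).
    rewrite mulmxBl mul1mx -mulmxA [LHS]mxE [X in _ + X = _]mxE.
    rewrite [(phi 0 *m (psi 0 *m aug F)) _ _]mxE [(phi 0 *m aug G) _ _]mxE.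
    under [X in _ = - (_ + X)]eq_bigr do rewrite mulrBr mul1r.
    by rewrite sumrB addrA mul1r subrK opprB.
  rewrite monomial_idealN; apply: monomial_idealD => //.
  by apply: monomial_ideal_sum => v _; apply: monomial_idealMl.
pose c k l (A : 'M[R]_(k, l)) := map_mx (mcoeff 0%MM) A.
apply: (@mulmx1_min _ _ _ (c _ _ (phi i)) (c _ _ (psi i))).
rewrite /c -map_mxM; apply/matrixP => u v; have := null u v.
rewrite !mxE mcoeffB => /eqP; rewrite subr_eq0 => /eqP E; apply: etrans E _.
by rewrite raddfMn /= mcoeff1 eqxx.
Qed.

End Resolutions.

(** * Homogeneous mapping cones *)

Section HomogeneousComponents.
Variables (K : fieldType) (n : nat).
Local Notation R := {mpoly K[n]}.
Implicit Types (f g : R) (m : 'X_{1..n}) (d k l : int).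

Definition homogeneous d f := forall m, m \in msupp f -> (mdeg m)%:Z = d.

(** Degrees are integers because the shifts of a graded sequence are. *)
Definition component d f : R :=
  \sum_(m <- msupp f | (mdeg m)%:Z == d) f@_m *: 'X_[m].

Lemma mcoeff_component d f m :
  (component d f)@_m = if (mdeg m)%:Z == d then f@_m else 0.
Proof.
rewrite raddf_sum /=; case: ifP => [dm | ndm]; last first.
  rewrite big1 // => k dk; rewrite mcoeffZ mcoeffX.
  by case: eqP => [km|_]; rewrite ?mulr0 //; rewrite -km dk in ndm.
have [mf | nmf] := boolP (m \in msupp f); last first.
  rewrite (memN_msupp_eq0 nmf) big_seq_cond big1 // => k /andP[kf _].
  rewrite mcoeffZ mcoeffX; case: eqP => [km|_]; rewrite ?mulr0 //.
  by rewrite -km kf in nmf.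
rewrite big_mkcond (bigD1_seq m) ?msupp_uniq //= dm mcoeffZ mcoeffX eqxx mulr1.
rewrite big1 ?addr0 // => k km.
by rewrite mcoeffZ mcoeffX (negPf km) mulr0 if_same.
Qed.

Lemma componentD d f g : component d (f + g) = component d f + component d g.
Proof.
apply/mpolyP => m; rewrite mcoeffD !mcoeff_component mcoeffD.
by case: ifP; rewrite ?addr0.
Qed.

Lemma component0 d : component d 0 = 0.
Proof. by apply/mpolyP => m; rewrite mcoeff_component mcoeff0 if_same. Qed.

Lemma component_sum d (I : Type) (r : seq I) (F : I -> R) :
  component d (\sum_(i <- r) F i) = \sum_(i <- r) component d (F i).
Proof. exact: (big_morph _ (componentD d) (component0 d)). Qed.

Lemma componentN d f : component d (- f) = - component d f.
Proof.
apply/mpolyP => m; rewrite mcoeffN !mcoeff_component mcoeffN.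
by case: ifP; rewrite ?oppr0.
Qed.

Lemma homogeneous_component d f : homogeneous d (component d f).
Proof.
move=> m; rewrite mcoeff_msupp mcoeff_component.
by case: ifP => [/eqP //|]; rewrite eqxx.
Qed.

Lemma component_id d f : homogeneous d f -> component d f = f.
Proof.
move=> df; apply/mpolyP => m; rewrite mcoeff_component.
case: ifP => // /eqP ndm; apply/esym/memN_msupp_eq0.
by apply/negP => /df.
Qed.

Lemma component_notin d f :
  (forall m, m \in msupp f -> (mdeg m)%:Z != d) -> component d f = 0.
Proof.
move=> df; apply/mpolyP => m; rewrite mcoeff_component mcoeff0.
by case: ifP => // dm; apply/memN_msupp_eq0/negP => /df; rewrite dm.
Qed.

Lemma componentMl d k f g :
  homogeneous k f -> component d (f * g) = f * component (d - k) g.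
Proof.
move=> kf; have := subrK (component (d - k) g) g.
set h := g - _ => hg; rewrite -{1}hg mulrDr componentD.
rewrite component_notin ?add0r => [|m /msuppM_le].
  apply: component_id => m /msuppM_le /allpairsP[[m1 m2] /=].
  by case=> /kf k1 /homogeneous_component k2 ->; rewrite mdegD; lia.
case/allpairsP=> -[m1 m2] /= [/kf k1 m2h ->]; rewrite mdegD.
apply/eqP => dm; move: m2h; rewrite mcoeff_msupp mcoeffB mcoeff_component.
by rewrite ifT ?subrr ?eqxx //; lia.
Qed.

Lemma componentMr d k f g :
  homogeneous k g -> component d (f * g) = component (d - k) f * g.
Proof. by move=> kg; rewrite mulrC (componentMl _ _ kg) mulrC. Qed.

Lemma monomial_ideal_component (P : pred 'X_{1..n}) d f :
  monomial_ideal P f -> monomial_ideal P (component d f).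
Proof.
move=> /allP Pf; apply/allP => m; rewrite mcoeff_msupp mcoeff_component.
by case: ifP => [_|]; rewrite ?eqxx // -mcoeff_msupp => /Pf.
Qed.

End HomogeneousComponents.

Section MappingCone.
Variables (K : fieldType) (n : nat).
Local Notation R := {mpoly K[n]}.
Local Notation ideal_of P := (fun f : R => is_true (monomial_ideal P f)).
Implicit Types (F G : graded_sequence K n) (P Q : pred 'X_{1..n}).

(** The entries of any comparison map may be replaced by their components of
    the expected degree: this preserves all the required identities, since the
    differentials are homogeneous and monomial ideals contain the homogeneous
    components of their elements. *)
Lemma homogeneous_comparison P Q (w : 'X_{1..n}) F G :
  upset P -> (forall m, Q m -> P (w + m)%MM) ->
  resolves_quotient (ideal_of P) F -> homogeneous_maps F ->
  resolves_quotient (ideal_of Q) G -> homogeneous_maps G ->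
  exists phi : forall i, 'M[R]_(rk G i, rk F i),
  [/\ forall u,
        monomial_ideal P ('X_[w] * aug G u ord0 - (phi 0 *m aug F) u ord0),
      forall i, phi i.+1 *m dif F i = dif G i *m phi i &
      forall i u v m, m \in msupp (phi i u v) ->
        (mdeg m)%:Z + sh v = sh u + (mdeg w)%:Z].
Proof.
move=> upP QP resF [hF0 hF] resG [hG0 hG].
have QXP (f : R) : monomial_ideal Q f -> monomial_ideal P ('X_[w] * f).
  by rewrite monomial_idealMX; apply: sub_monomial_ideal.
have [phi [phi0 phiS]] := comparison upP QXP resF resG.
have homF i u v : homogeneous (sh u - sh v) (dif F i u v).
  by move=> m /hF; lia.
have homG i u v : homogeneous (sh u - sh v) (dif G i u v).
  by move=> m /hG; lia.
pose psi i : 'M[R]_(rk G i, rk F i) :=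
  \matrix_(u, v) component (sh u + (mdeg w)%:Z - sh v) (phi i u v).
exists psi; split.
- move=> u; have := monomial_ideal_component (sh u + (mdeg w)%:Z) (phi0 u).
  rewrite componentD componentN component_id; last first.
    move=> m /msuppM_le /allpairsP[[m1 m2] /= [+ /hG0 m2u ->]].
    by rewrite msuppX inE => /eqP->; rewrite mdegD; lia.
  congr (is_true (monomial_ideal _ (_ - _))).
  rewrite !mxE component_sum; apply: eq_bigr => v _.
  by rewrite (componentMr _ _ (hF0 _ _)) mxE.
- move=> i; apply/matrixP => u v; rewrite !mxE.
  transitivity (component (sh u + (mdeg w)%:Z - sh v)
    ((phi i.+1 *m dif F i) u v)).
    rewrite mxE component_sum; apply: eq_bigr => j _.
    rewrite (componentMr _ _ (homF _ _ _)) mxE; congr (component _ _ * _).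
    lia.
  rewrite phiS mxE component_sum; apply: eq_bigr => j _.
  rewrite (componentMl _ _ (homG _ _ _)) mxE; congr (_ * component _ _).
  lia.
- by move=> i u v m; rewrite mxE => /homogeneous_component; lia.
Qed.

Definition cone_rk F G i := if i is j.+1 then (rk F j.+1 + rk G j)%N else rk F
  0.

(** The case distinctions are there because the shifted copy of [G] contributes
    nothing in homological degree 0; [k] is the shift of the internal degree on
    [G]. *)
Definition cone F G (phi : forall i, 'M[R]_(rk G i, rk F i)) (k : int) :
    graded_sequence K n :=
  @GradedSequence K n (cone_rk F G)
    (fun i => if i is j.+1 return 'I_(cone_rk F G i) -> int
              then fun u => match split u with
                            | inl v => sh v | inr v => sh v + k end
              else @sh _ _ F 0)
    (aug F)
    (fun i => if i is j.+1
                return 'M[R]_(cone_rk F G i.+1, cone_rk F G i)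
              then block_mx (dif F j.+1) 0 (phi j.+1) (- dif G j)
              else col_mx (dif F 0) (phi 0)).

Definition has_resolution P p := exists F : graded_sequence K n,
  minimal_free_resolution (ideal_of P) F /\ has_length F p.

(** The map of which the cone is taken is the variable of index [i0] times the
    lift [phi] of the multiplication by the monomial [w]; the variable being a
    nonzerodivisor modulo the ideal of [P], the cone resolves the quotient by
    the sum of this ideal and of the product of the variable and [w]. *)
Section Exactness.
Variables (P : pred 'X_{1..n}) (w : 'X_{1..n}) (i0 : 'I_n).
Variables (F G : graded_sequence K n).
Variable (phi : forall i, 'M[R]_(rk G i, rk F i)).
Hypothesis upP : upset P.
Hypothesis nzd : forall m, P (U_(i0) + m)%MM -> P m.
Hypothesis resF : resolves_quotient (ideal_of P) F.
Hypothesis resG : resolves_quotient (ideal_of (fun m => P (w + m)%MM)) G.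
Hypothesis phi0 : forall u,
  monomial_ideal P ('X_[w] * aug G u ord0 - (phi 0 *m aug F) u ord0).
Hypothesis phiS : forall i, phi i.+1 *m dif F i = dif G i *m phi i.

Let xphi i := 'X_i0 *: phi i.

Let phi0_row (c : 'rV[R]_(rk G 0)) :
  monomial_ideal P ('X_[w] * (c *m aug G) ord0 ord0
                    - (c *m phi 0 *m aug F) ord0 ord0).
Proof.
rewrite -mulmxA !mxE mulr_sumr -sumrB; apply: monomial_ideal_sum => u _.
by rewrite mulrCA -mulrBr; apply: monomial_idealMl.
Qed.

Let nzdX (f : R) : monomial_ideal P ('X_i0 * f) = monomial_ideal P f.
Proof.
apply/idP/idP; last exact: monomial_idealMl.
by rewrite monomial_idealMX; apply: sub_monomial_ideal.
Qed.

Let xphi_aug (c : 'rV[R]_(rk G 0)) :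
  (c *m xphi 0 *m aug F) ord0 ord0 = 'X_i0 * (c *m phi 0 *m aug F) ord0 ord0.
Proof. by rewrite /xphi -scalemxAr -scalemxAl mxE. Qed.

Let exact0 (v : 'rV[R]_(rk F 0)) :
  monomial_ideal (fun m => P m || (U_(i0) + w <= m)%MM)
    ((v *m aug F) ord0 ord0) <->
  exists z : 'rV[R]_(rk F 1 + rk G 0), v = z *m col_mx (dif F 0) (xphi 0).
Proof.
split=> [/monomial_ideal_addX[c vc] | [z ->]].
  have [sG _ _] := resG; have [z zc] := sG c.
  have /(exact_aug resF)[y yE] : forall j, monomial_ideal P
      (((v - z *m xphi 0) *m aug F) j ord0).
    move=> j; rewrite ord1 mulmxBl mxE [(- _ : 'M__) _ _]mxE.
    rewrite xphi_aug.
    set a := (v *m _) _ _ in vc *; set b := (_ *m aug F) _ _.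
    have -> : a - 'X_i0 * b = (a - c * 'X_[U_(i0) + w]) +
        'X_i0 * ('X_[w] * (c - (z *m aug G) ord0 ord0) +
                 ('X_[w] * (z *m aug G) ord0 ord0 - b)).
      by rewrite mpolyXD; ring.
    apply: monomial_idealD => //; rewrite nzdX; apply: monomial_idealD.
      by rewrite monomial_idealMX.
    exact: phi0_row.
  by exists (row_mx y z); rewrite mul_row_col -yE subrK.
rewrite -[z]hsubmxK mul_row_col mulmxDl mxE.
apply: monomial_idealD.
  apply: (@sub_monomial_ideal _ _ P) => [m ->//|].
  have [_ ex _] := resF; apply/ex; by eexists.
set z' := rsubmx z.
have -> : (z' *m xphi 0 *m aug F) ord0 ord0 =
    'X_[U_(i0) + w] * (z' *m aug G) ord0 ord0 -
    'X_i0 * ('X_[w] * (z' *m aug G) ord0 ord0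
                    - (z' *m phi 0 *m aug F) ord0 ord0).
  by rewrite xphi_aug mpolyXD; ring.
apply: monomial_idealB.
  rewrite monomial_idealMX; apply/allP => m _; rewrite lem_addr //.
  by rewrite orbT.
apply: (@sub_monomial_ideal _ _ P) => [m ->//|].
by rewrite nzdX; apply: phi0_row.
Qed.

Let xphiS i : xphi i.+1 *m dif F i = dif G i *m xphi i.
Proof. by rewrite /xphi -scalemxAr -scalemxAl phiS. Qed.

Let exact1 (v : 'rV[R]_(rk F 1 + rk G 0)) :
  v *m col_mx (dif F 0) (xphi 0) = 0 <->
  exists z : 'rV[R]_(rk F 2 + rk G 1),
    v = z *m block_mx (dif F 1) 0 (xphi 1) (- dif G 0).
Proof.
rewrite -[v]hsubmxK; set a := lsubmx v; set c := rsubmx v.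
rewrite mul_row_col; split=> [ac0 | [z]].
  have /(exact_aug resG)[z zE] : forall j,
      monomial_ideal (fun m => P (w + m)%MM) ((c *m aug G) j ord0).
    move=> j; rewrite ord1 -monomial_idealMX -nzdX.
    have -> : 'X_i0 * ('X_[w] * (c *m aug G) ord0 ord0) =
        'X_i0 * ('X_[w] * (c *m aug G) ord0 ord0
                    - (c *m phi 0 *m aug F) ord0 ord0) -
        (a *m dif F 0 *m aug F) ord0 ord0 +
        ((a *m dif F 0 + c *m xphi 0) *m aug F) ord0 ord0.
      by rewrite mulmxDl [(_ + _ : 'M__) _ _]mxE xphi_aug; ring.
    rewrite ac0 mul0mx [(0 : 'M__) _ _]mxE addr0; apply: monomial_idealB.
      by rewrite nzdX; apply: phi0_row.
    have [_ ex _] := resF; apply/ex; by eexists.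
  have /(exact_dif resF)[y yE] : (a + z *m xphi 1) *m dif F 0 = 0.
    by rewrite mulmxDl -mulmxA xphiS mulmxA -zE.
  exists (row_mx y (- z)); rewrite mul_row_block -yE mulmx0 add0r.
  by rewrite mulmxN !mulNmx opprK -zE addrK.
rewrite -[z]hsubmxK mul_row_block mulmx0 add0r => /eq_row_mx[-> ->].
rewrite mulmxN mulNmx mulmxDl -!mulmxA xphiS (dif_dif _ resF).
by rewrite mulmx0 add0r subrr.
Qed.

Let exact2 i (v : 'rV[R]_(rk F i.+2 + rk G i.+1)) :
  v *m block_mx (dif F i.+1) 0 (xphi i.+1) (- dif G i) = 0 <->
  exists z : 'rV[R]_(rk F i.+3 + rk G i.+2),
    v = z *m block_mx (dif F i.+2) 0 (xphi i.+2) (- dif G i.+1).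
Proof.
rewrite -[v]hsubmxK; set a := lsubmx v; set c := rsubmx v.
rewrite mul_row_block mulmx0 add0r; split=> [|[z]].
  rewrite -row_mx0 => /eq_row_mx[ac0 /eqP].
  rewrite mulmxN oppr_eq0 => /eqP /(exact_dif resG)[z zE].
  have /(exact_dif resF)[y yE] : (a + z *m xphi i.+2) *m dif F i.+1 = 0.
    by rewrite mulmxDl -mulmxA xphiS mulmxA -zE.
  exists (row_mx y (- z)); rewrite mul_row_block -yE mulmx0 add0r.
  by rewrite mulmxN !mulNmx opprK -zE addrK.
rewrite -[z]hsubmxK mul_row_block mulmx0 add0r => /eq_row_mx[-> ->].
rewrite mulmxN mulNmx mulmxDl -!mulmxA xphiS (dif_dif _ resF).
rewrite mulmx0 add0r subrr mulmxN mulNmx opprK -mulmxA (dif_dif _ resG).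
by rewrite mulmx0 row_mx0.
Qed.

Lemma cone_resolves :
  resolves_quotient (ideal_of (fun m => P m || (U_(i0) + w <= m)%MM))
    (cone xphi (mdeg (U_(i0) + w))%:Z).
Proof.
split=> [f|v|[|i] v]; [|exact: exact0|exact: exact1|exact: exact2].
have [sF _ _] := resF; have [v fv] := sF f; exists v.
by apply: sub_monomial_ideal fv => m ->.
Qed.

End Exactness.

(** The factor ['X_i] in the map between the resolutions is what makes the cone
    minimal, so that its length is exactly the expected one. *)
Lemma has_resolution_cone P (i : 'I_n) (w : 'X_{1..n}) p q :
  upset P -> (forall m, P (U_(i) + m)%MM -> P m) ->
  has_resolution P p -> has_resolution (fun m => P (w + m)%MM) q ->
  has_resolution (fun m => P m || (U_(i) + w <= m)%MM) (maxn p q.+1).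
Proof.
move=> upP nzd [F [[hF rF mF] [lF0 lF]]] [G [[hG rG mG] [lG0 lG]]].
have [phi [phi0 phiS hphi]] :=
  homogeneous_comparison upP (fun m Pm => Pm) rF hF rG hG.
exists (cone (fun j => 'X_i *: phi j) (mdeg (U_(i) + w))%:Z).
have hX j u v m : m \in msupp (('X_i *: phi j) u v) ->
    (mdeg m)%:Z + sh v = sh u + (mdeg (U_(i) + w))%:Z.
  rewrite mxE => /msuppM_le /allpairsP[[m1 m2] /= [+ /hphi m2P ->]].
  by rewrite msuppX inE => /eqP->; rewrite !mdegD mdeg1; lia.
have X0 j u v : (('X_i *: phi j) u v)@_0%MM = 0.
  by rewrite mxE (rmorphM (mcoeff 0%MM)) /= mcoeffX mnm1_eq0 mul0r.
have [hF0 {}hF] := hF; have [hG0 {}hG] := hG.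
split; [split|split].
- split=> [//|[|j] u v m /=].
    by rewrite mxE; case: splitP => k _ ; [apply: hF | move/hX].
  rewrite /block_mx !mxE; case: splitP => k _; rewrite mxE.
    by case: splitP => l _; [apply: hF | rewrite mxE msupp0].
  case: splitP => l _; first by move/hX.
  rewrite mxE (perm_mem (msuppN _)) => /hG.
  by move=> <-; rewrite addrA.
- exact: cone_resolves.
- move=> [|j] u v /=; first by rewrite mxE; case: splitP => k _.
  rewrite /block_mx !mxE; case: splitP => k _; rewrite mxE;
    case: splitP => l _ //.
    by rewrite mxE mcoeff0.
  by rewrite mxE mcoeffN mG oppr0.
- rewrite /= /cone_rk; case: (leqP p q.+1) => pq.
    by rewrite addn_gt0 lG0 orbT.
  by case: p lF0 lF pq => // p lF0 _ _; rewrite addn_gt0 lF0.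
- case=> // j; rewrite gtn_max => /andP[pj qj] /=.
  by rewrite lF // lG.
Qed.

Lemma has_resolution0 : has_resolution pred0 0.
Proof.
pose F := @GradedSequence K n (fun i => (i == 0)%N) (fun _ _ => 0)
  (1%:M : 'M_1) (fun i => 0).
exists F; split; last by split=> // -[].
have ide f : monomial_ideal pred0 f <-> f = 0.
  split=> [|->]; last exact: monomial_ideal0.
  by rewrite /monomial_ideal all_pred0 => /nilP/msuppnil0.
split.
- split=> [u j m|i u]; last by case: u.
  by rewrite mxE !ord1 msupp1 inE => /eqP->; rewrite mdeg0.
- split=> [f|v|i v].
  + exists (const_mx f); apply/ide; rewrite mulmx1 mxE subrr //.
  + rewrite ide mulmx1; split=> [v0|[z ->]]; last by rewrite mulmx0 mxE.
    by exists 0; rewrite mulmx0; apply/matrixP => j k; rewrite !ord1 mxE.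
  + by split=> _; [exists 0; apply/matrixP => j [] | rewrite mulmx0].
- by move=> i [].
Qed.

Lemma eq_has_resolution P Q p :
  P =1 Q -> has_resolution P p -> has_resolution Q p.
Proof.
move=> PQ [F [mF lF]]; exists F; split=> //.
by apply: eq_minimal_free_resolution mF => f; rewrite (eq_monomial_ideal _ PQ).
Qed.

Lemma has_resolution_is_pd P p (I : R -> Prop) :
  upset P -> (forall f, monomial_ideal P f <-> I f) ->
  has_resolution P p -> is_pd I p.
Proof.
move=> upP PI [F [mF [lF0 lF]]]; split.
  by exists F; apply: eq_minimal_free_resolution mF.
move=> G mG; have {}mG : minimal_free_resolution (ideal_of P) G.
  by apply: eq_minimal_free_resolution mG => f; split=> /PI.
split; first by apply: leq_trans lF0 (minimal_rank_le _ upP mF mG).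
move=> i /lF Fi; apply/eqP; rewrite -leqn0 -Fi.
exact: minimal_rank_le upP mG mF.
Qed.

End MappingCone.

(** * Systems of parameters of a polynomial ring *)

Section SystemOfParameters.
Variables (K : fieldType) (t s N : nat) (p : 'I_s -> {mpoly K[t]}).
Local Notation R := {mpoly K[t]}.
Hypothesis p0 : forall i, (p i)@_0%MM = 0.
Hypothesis pX : forall j, exists c : 'I_s -> R, 'X_j ^+ N = \sum_i c i * p i.

(* Membership in the [k]-th power of the maximal ideal. *)
Let order_ge k := monomial_ideal (K := K) (fun m : 'X_{1..t} => k <= mdeg m)%N.

Let order_geM k l f g :
  order_ge k f -> order_ge l g -> order_ge (k + l) (f * g).
Proof.
move=> /allP kf /allP lg; apply/allP => m /msuppM_le /allpairsP[[m1 m2] /=].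
by case=> /kf k1 /lg l2 ->; rewrite mdegD leq_add.
Qed.

Let order_ge0 f : order_ge 0 f.
Proof. exact/allP. Qed.

Let order_geX k f l : order_ge k f -> order_ge (k * l) (f ^+ l).
Proof.
move=> kf; elim: l => [|l IH]; first by rewrite muln0.
by rewrite mulnS exprS; apply: order_geM.
Qed.

Let power (a : 'X_{1..s}) : R := \prod_i p i ^+ a i.

Let powerD a i : power (a + U_(i)) = p i * power a.
Proof.
rewrite /power (bigD1 i) //= [in RHS](bigD1 i) //= mnmDE mnm1E eqxx addn1.
rewrite exprS mulrA; congr (_ * _); apply: eq_bigr => j ji.
by rewrite mnmDE mnm1E eq_sym (negPf ji) addn0.
Qed.

Let order_power a : order_ge (mdeg a) (power a).
Proof.
rewrite /power mdegE.
apply: (big_rec2 (fun k f => is_true (order_ge k f))) => [|i k f _ kf].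
  exact: order_ge0.
apply: order_geM => //; rewrite -[X in order_ge X _]mul1n; apply: order_geX.
apply/allP => m; rewrite mcoeff_msupp lt0n mdeg_eq0.
by apply: contraNneq => ->; rewrite p0.
Qed.

Variable l : nat.
Let box := {ffun 'I_t -> 'I_l}.
Let k := (t * l)%N.
(* The products of a monomial in [p], with exponents below [k], and of a
   monomial in the variables, with exponents below [N], span all polynomials
   modulo the [k]-th power of the maximal ideal. The exponents are bounded one
   by one rather than in total degree to keep the count elementary. *)
Let gen : finType := ({ffun 'I_s -> 'I_k} * {ffun 'I_t -> 'I_N})%type.
Let mon u v (b : {ffun 'I_u -> 'I_v}) : 'X_{1..u} := [multinom (b i :
  nat) | i < u].

Let truncate (f : R) : 'rV[K]_#|box| := \row_b f@_(mon (enum_val b)).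

Let M : 'M[K]_(#|gen|, #|box|) :=
  \matrix_a truncate ('X_[mon (enum_val a).2] * power (mon (enum_val a).1)).

Let truncateD f g : truncate (f + g) = truncate f + truncate g.
Proof. by apply/rowP => b; rewrite !mxE mcoeffD. Qed.

Let truncateZ c f : truncate (c *: f) = c *: truncate f.
Proof. by apply/rowP => b; rewrite !mxE mcoeffZ. Qed.

Let truncate0 : truncate 0 = 0.
Proof. by apply/rowP => b; rewrite !mxE mcoeff0. Qed.

Let truncate_sum (I : Type) (r : seq I) (F : I -> R) :
  (forall i, (truncate (F i) <= M)%MS) ->
  (truncate (\sum_(i <- r) F i) <= M)%MS.
Proof.
move=> FM; apply: (big_ind (fun f => is_true (truncate f <= M)%MS)) => //.
  by rewrite truncate0 sub0mx.
by move=> f g fM gM; rewrite truncateD addmx_sub.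
Qed.

Let truncate_order f : (0 < t)%N -> (0 < l)%N -> order_ge k f -> truncate f = 0.
Proof.
move=> t0 l0 /allP kf; apply/rowP => b; rewrite !mxE; apply: memN_msupp_eq0.
apply/negP => /kf; apply/negP; rewrite -ltnNge mdegE.
apply: (@leq_ltn_trans (t * l.-1)).
  rewrite -[t in (t * _)%N]card_ord -sum_nat_const; apply: leq_sum => i _.
  by rewrite mnmE -ltnS (prednK l0) ltn_ord.
by rewrite /k ltn_pmul2l // prednK.
Qed.

(* A monomial with an exponent at least [N] lies in the ideal of the [p i],
   which raises the degree [mdeg a] in [p]; once this degree reaches [k], the
   truncation vanishes. The induction is on the number [d] of steps left. *)
Let span_truncate : (0 < t)%N -> (0 < l)%N ->
  forall d a g, (k <= mdeg a + d)%N -> (truncate (g * power a) <= M)%MS.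
Proof.
move=> t0 l0; elim=> [|d IH] a g ka.
  rewrite truncate_order ?sub0mx //; apply: monomial_idealMl.
    by move=> m n; rewrite mdegD => /leq_trans->; rewrite ?leq_addr.
  by apply: sub_monomial_ideal (order_power a) => m; apply: leq_trans; lia.
rewrite [g]mpolyE mulr_suml; apply: truncate_sum => m.
rewrite -scalerAl truncateZ scalemx_sub //.
have [/forallP mN | ] := boolP [forall j, m j < N]%N; last first.
  rewrite negb_forall => /existsP[j]; rewrite -leqNgt => Nm.
  have Um : (U_(j) *+ N <= m)%MM.
    apply/mnm_lepP => i; rewrite mulmnE mnm1E.
    by case: eqP => [<-|]; rewrite ?mul1n // mul0n.
  have [c cE] := pX j.
  rewrite -(submK Um) mpolyXD -mpolyXn cE mulr_sumr mulr_suml.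
  apply: truncate_sum => i; rewrite [_ * (c i * p i)]mulrA -(mulrA (_ * c i))
    -powerD; apply: IH.
  by rewrite mdegD mdeg1; lia.
have [ka' | ak] := leqP k (mdeg a).
  by apply: IH; lia.
have ak' i : (a i < k)%N.
  by apply: leq_ltn_trans ak; rewrite mdegE (bigD1 i) //= leq_addr.
pose A := [ffun i => Ordinal (ak' i)]; pose B := [ffun j => Ordinal (mN j)].
have -> : truncate ('X_[m] * power a) = row (enum_rank (A, B)) M.
  rewrite rowK enum_rankK /=; congr (truncate ('X_[_] * power _)).
    by apply/mnmP => j; rewrite mnmE ffunE.
  by apply/mnmP => j; rewrite mnmE ffunE.
exact: row_sub.
Qed.

(** The monomials with all exponents below [l] have degree less than [t * l],
    hence are linearly independent modulo the [t * l]-th power of the maximal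
    ideal, and there are at most as many of them as of spanning products. *)
Lemma box_le : (0 < t)%N -> (0 < l)%N -> (l ^ t <= (t * l) ^ s * N ^ t)%N.
Proof.
move=> t0 l0.
have -> : (l ^ t)%N = #|box| by rewrite card_ffun !card_ord.
have -> : ((t * l) ^ s * N ^ t)%N = #|gen|.
  by rewrite card_prod !card_ffun !card_ord.
rewrite -(mxrank1 K #|box|); apply: leq_trans (rank_leq_row M).
apply: mxrankS; apply/row_subP => b.
have -> : row b 1%:M = truncate ('X_[mon (enum_val b)] * power 0).
  rewrite /power big1 ?mulr1 => [|i _]; last by rewrite mnm0E expr0.
  apply/rowP => c; rewrite !mxE mcoeffX; congr (_%:R); congr nat_of_bool.
  apply/eqP/eqP => [->//|/mnmP bc]; apply: enum_val_inj; apply/ffunP => i.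
  by have := bc i; rewrite !mnmE => /val_inj.
by apply: (span_truncate t0 l0 (d := k)); rewrite leq_addl.
Qed.

End SystemOfParameters.

(** The case of Krull's height theorem needed here: the maximal ideal at the
    origin is not minimal over fewer than [t] elements. If [s < t], then
    [box_le] fails for large [l], the powers of [l] being [t] and [s]. *)
Lemma parameters_ge (K : fieldType) (t s : nat) (p : 'I_s -> {mpoly K[t]}) :
  (forall i, (p i)@_0%MM = 0) ->
  (forall j, radical (ideal_gen (fun g => exists i, g = p i)) 'X_j) ->
  (t <= s)%N.
Proof.
move=> p0 pX.
have /fin_all_exists[N NX] j : exists N, exists c : 'I_s -> {mpoly K[t]},
    'X_j ^+ N = \sum_i c i * p i.
  have [N [k [c [q [qp XE]]]]] := pX j; exists N.
  have [f fp] := fin_all_exists qp.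
  exists (fun i => \sum_(u | f u == i) c u).
  rewrite XE.
  rewrite (partition_big f predT) //=; apply: eq_bigr => i _.
  by rewrite mulr_suml; apply: eq_bigr => u /eqP <-; rewrite fp.
rewrite leqNgt; apply/negP => st.
pose m := \sum_j N j.
have {}NX j : exists c : 'I_s -> {mpoly K[t]}, 'X_j ^+ m = \sum_i c i * p i.
  have [c cE] := NX j; exists (fun i => 'X_j ^+ (m - N j) * c i).
  under eq_bigr do rewrite -mulrA.
  by rewrite -mulr_sumr -cE -exprD subnK // /m (bigD1 j) //= leq_addr.
pose l := (t ^ s * m ^ t).+1.
have t0 : (0 < t)%N by apply: leq_ltn_trans st.
have := box_le p0 NX t0 (ltn0Sn (t ^ s * m ^ t)).
rewrite -/l leqNgt => /negP[]; rewrite expnMn mulnAC.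
apply: (@leq_trans (l * l ^ s)); first by rewrite ltn_pmul2r // expn_gt0.
by rewrite -expnS leq_pexp2l.
Qed.

(** * Generation up to radical *)

Section IdealGen.
Variables (R : comNzRingType) (S : R -> Prop).
Local Notation I := (ideal_gen S).
Implicit Types f g c : R.

Lemma ideal_gen_mem f : S f -> I f.
Proof.
by move=> Sf; exists 1, (fun _ => 1), (fun _ => f); rewrite big_ord1 mul1r.
Qed.

Lemma ideal_gen0 : I 0.
Proof. by exists 0, (fun _ => 0), (fun _ => 0); split=> [[]|];
  rewrite ?big_ord0. Qed.

Lemma ideal_genD f g : I f -> I g -> I (f + g).
Proof.
move=> [k [c [s [Ss ->]]]] [l [d [t [St ->]]]].
exists (k + l)%N, (fun i => match split i with inl j => c j | inr j => d j end),
  (fun i => match split i with inl j => s j | inr j => t j end).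
split=> [i|]; first by case: split.
rewrite big_split_ord /=; congr (_ + _); apply: eq_bigr => i _.
  by rewrite (unsplitK (inl i)).
by rewrite (unsplitK (inr i)).
Qed.

Lemma ideal_genMl c f : I f -> I (c * f).
Proof.
move=> [k [d [s [Ss ->]]]]; exists k, (fun i => c * d i), s; split=> //.
by rewrite mulr_sumr; apply: eq_bigr => i _; rewrite mulrA.
Qed.

Lemma ideal_gen_sum (T : Type) (r : seq T) (P : pred T) (F : T -> R) :
  (forall i, P i -> I (F i)) -> I (\sum_(i <- r | P i) F i).
Proof.
by move=> IF; elim/big_ind: _ => //; [exact: ideal_gen0 | exact: ideal_genD].
Qed.

Lemma radical_mem f : I f -> radical I f.
Proof. by move=> If; exists 1; rewrite expr1. Qed.

Lemma radicalX f k : radical I (f ^+ k) -> radical I f.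
Proof. by case=> l; rewrite -exprM; exists (k * l)%N. Qed.

Lemma radicalMl c f : radical I f -> radical I (c * f).
Proof. by case=> k If; exists k; rewrite exprMn; apply: ideal_genMl. Qed.

Lemma radicalD f g : radical I f -> radical I g -> radical I (f + g).
Proof.
case=> k If [l Ig]; exists (k + l)%N; rewrite exprDn.
apply: ideal_gen_sum => i _; rewrite -mulr_natl; apply: ideal_genMl.
have [il | li] := leqP l i.
  by rewrite -(subnK il) exprD mulrA; apply: ideal_genMl.
have -> : (k + l - i = l - i + k)%N by lia.
by rewrite exprD mulrAC; apply: ideal_genMl.
Qed.

Lemma radicalB f g : radical I f -> radical I g -> radical I (f - g).
Proof. by move=> If Ig; rewrite -mulN1r; apply/radicalD/radicalMl. Qed.

Lemma radical_sum (T : Type) (r : seq T) (P : pred T) (F : T -> R) :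
  (forall i, P i -> radical I (F i)) -> radical I (\sum_(i <- r | P i) F i).
Proof.
move=> IF; elim/big_ind: _ => //; [|exact: radicalD].
exact/radical_mem/ideal_gen0.
Qed.

End IdealGen.

(** By induction, every [a i] is in the radical of the ideal of the [q i]: so
    is [a i * b i], a multiple of an earlier [a j], and [a i ^+ 2 = a i * q i -
    a i * b i]. *)
Lemma tree_like_radical (R : comNzRingType) r (q a : 'I_r.+1 -> R)
    (b : 'I_r -> R) (S : R -> Prop) :
  tree_like_system q a b -> (forall f, tree_like_support a b f <-> S f) ->
  generates_up_to_radical q (ideal_gen S).
Proof.
case=> _ _ _ [q0 qS] dv supp.
pose J := ideal_gen (fun g => exists i, g = q i).
have Jq i : radical J (q i) by apply/radical_mem/ideal_gen_mem; exists i.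
have Ja : forall m (i : 'I_r.+1), (i <= m)%N -> radical J (a i).
  elim=> [|m IH] i im.
    have -> : i = ord0 by apply/val_inj/eqP; rewrite /= -leqn0.
    by rewrite -q0.
  case: (unliftP ord0 i) im => [j|] -> im; last by rewrite -q0.
  have [k [kj [c ab]]] := dv j.
  apply: (@radicalX _ _ _ 2).
  have -> : a (lift ord0 j) ^+ 2 =
      a (lift ord0 j) * q (lift ord0 j) - a (lift ord0 j) * b j.
    by rewrite qS mulrDr addrK expr2.
  apply: radicalB; first exact: radicalMl.
  by rewrite ab; apply/radicalMl/IH; rewrite -ltnS (leq_trans kj).
have {}Ja i : radical J (a i) by apply: (Ja i i).
have Jb i : radical J (b i).
  have -> : b i = q (lift ord0 i) - a (lift ord0 i) by rewrite qS addrC addKr.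
  exact: radicalB.
have Sa i : S (a i) by apply/supp; left; exists i.
have Ib i : ideal_gen S (b i).
  have [->|b0] := eqVneq (b i) 0; first exact: ideal_gen0.
  by apply/ideal_gen_mem/supp; right; exists i.
move=> f; split=> -[k].
  case=> l [c [s [sq fE]]]; exists k; rewrite fE.
  apply: ideal_gen_sum => i _; apply: ideal_genMl; have [j ->] := sq i.
  case: (unliftP ord0 j) => [j'|] ->.
    by rewrite qS; apply: ideal_genD => //; apply/ideal_gen_mem.
  by rewrite q0; apply/ideal_gen_mem.
case=> l [c [s [sS fE]]]; apply: (@radicalX _ _ _ k); rewrite fE.
apply: radical_sum => i _; apply: radicalMl.
by have /supp[[j ->]|[j [_ ->]]] := sS i.
Qed.

(** * Edge ideals and vertex covers *)

Section EdgeIdeals.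
Variables (K : fieldType) (V : finType) (e : rel V).
Hypotheses (e_sym : ssrbool.symmetric e) (e_irr : irreflexive e).
Local Notation R := (vertex_ring K V).
Local Notation mon := 'X_{1..#|V|}.
Implicit Types (S A : {set V}) (m : mon).

(** The monomials of the edge ideal of the subgraph induced on [S]. *)
Definition edge_in S m := [exists u in S, [exists v in S,
  [&& e u v, 0 < m (enum_rank u) & 0 < m (enum_rank v)]]]%N.

Lemma edge_inP S m : reflect (exists u v, [/\ u \in S, v \in S, e u v,
  (0 < m (enum_rank u))%N & (0 < m (enum_rank v))%N]) (edge_in S m).
Proof.
apply: (iffP exists_inP) => [[u uS /exists_inP[v vS /and3P[]]] | [u [v []]]].
  by exists u, v.
move=> uS vS uv mu mv; exists u => //; apply/exists_inP; exists v => //.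
exact/and3P.
Qed.

Lemma upset_edge_in S : upset (edge_in S).
Proof.
move=> m k /edge_inP[u [v [uS vS uv mu mv]]]; apply/edge_inP; exists u, v.
by split; rewrite // mnmDE addn_gt0 ?mu ?mv.
Qed.

Lemma mnmU_le2 u v m : u != v ->
  (U_(enum_rank u) + U_(enum_rank v) <= m)%MM =
  (0 < m (enum_rank u))%N && (0 < m (enum_rank v))%N.
Proof.
move=> uv; have ruv : (enum_rank u == enum_rank v) = false.
  by apply: contra_neqF uv => /eqP /enum_rank_inj.
apply/mnm_lepP/andP => [le|[mu mv] i].
  have [lu lv] := (le (enum_rank u), le (enum_rank v)).
  rewrite !mnmDE !mnm1E !eqxx ?ruv in lu lv; split; last by rewrite lv.
  by rewrite (leq_trans _ lu) // leq_addr.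
rewrite mnmDE !mnm1E.
have [<-|_] := eqP; first by rewrite eq_sym ruv.
by case: eqP => [<-|].
Qed.

Lemma edge_idealP (f : R) :
  monomial_ideal (edge_in [set: V]) f <-> edge_ideal e f.
Proof.
split=> [/allP fP | [k [c [s [ss ->]]]]].
  rewrite [f]mpolyE big_seq; apply: ideal_gen_sum => m /fP.
  case/edge_inP=> u [v [_ _ uv mu mv]].
  have nuv : u != v by apply: contraTneq uv => ->; rewrite e_irr.
  have le_m : (U_(enum_rank u) + U_(enum_rank v) <= m)%MM.
    by rewrite mnmU_le2 // mu.
  rewrite -(submK le_m) mpolyXD scalerAl; apply/ideal_genMl/ideal_gen_mem.
  by exists u, v; rewrite mpolyXD.
apply: monomial_ideal_sum => i _.
apply: monomial_idealMl; first exact: upset_edge_in.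
have [u [v [uv ->]]] := ss i; rewrite -mpolyXD -['X_[_]]scale1r.
apply: monomial_idealZX; apply/edge_inP; exists u, v.
by split; rewrite ?inE // mnmDE !mnm1E eqxx addn_gt0 ?orbT.
Qed.

Definition nbrs S v := [set u in S | e v u].

(** The complements in [S] are the minimal vertex covers of the subgraph induced
    on [S]. *)
Definition maximal_independent S A :=
  [/\ A \subset S, {in A &, forall u v, ~~ e u v}
    & forall v, v \in S :\: A -> exists2 u, u \in A & e v u].

(** Setting the variables in [A] to 1 has the effect of localizing at the
    minimal prime generated by the other ones, without leaving polynomial
    rings: each vertex of the cover has a neighbour in [A], so that its
    variable is in the image of the edge ideal. *)
Section Specialization.
Variable A : {set V}.
Hypothesis maxA : maximal_independent [set: V] A.
Let C := ~: A.

Let spec_var (i : 'I_#|V|) : {mpoly K[#|C|]} :=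
  if [pick j : 'I_#|C| | enum_val j == enum_val i] is Some j then 'X_j else 1.

Let spec (f : R) := f \mPo [tuple spec_var i | i < #|V|].

Let specM f g : spec (f * g) = spec f * spec g.
Proof. exact: rmorphM. Qed.

Let specX f k : spec (f ^+ k) = spec f ^+ k.
Proof. exact: rmorphXn. Qed.

Let spec_sum k (f : 'I_k -> R) : spec (\sum_i f i) = \sum_i spec (f i).
Proof. exact: rmorph_sum. Qed.

Let spec_vertex v : spec (vertex_var K v) =
  if [pick j : 'I_#|C| | enum_val j == v] is Some j then 'X_j else 1.
Proof. by rewrite /spec /vertex_var comp_mpolyXU -tnth_nth tnth_mktuple
  /spec_var enum_rankK. Qed.

Let spec_cover (j : 'I_#|C|) : spec (vertex_var K (enum_val j)) = 'X_j.
Proof.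
by rewrite spec_vertex; case: pickP => [k /eqP/enum_val_inj->//|/(_ j)];
  rewrite eqxx.
Qed.

Let spec_ind v : v \in A -> spec (vertex_var K v) = 1.
Proof.
rewrite spec_vertex; case: pickP => // j /eqP <-.
by have := enum_valP j; rewrite inE => /negPf->.
Qed.

Let spec_edge u v : e u v -> (spec (vertex_var K u * vertex_var K v))@_0%MM = 0.
Proof.
have const0 w : w \notin A -> (spec (vertex_var K w))@_0%MM = 0.
  move=> wA; have wC : w \in C by rewrite inE.
  by rewrite -(enum_rankK_in wC wC) spec_cover mcoeffX mnm1_eq0.
have [_ indA _] := maxA => uv.
rewrite specM (rmorphM (mcoeff 0%MM)) /=.
have [uA | /const0->] := boolP (u \in A); last by rewrite mul0r.
have [vA | /const0->] := boolP (v \in A); last by rewrite mulr0.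
by have := indA u v uA vA; rewrite uv.
Qed.

Lemma cover_le_generators s (q : 'I_s -> R) :
  generates_up_to_radical q (edge_ideal e) -> (#|~: A| <= s)%N.
Proof.
move=> qI; apply: (@parameters_ge K _ _ (fun i => spec (q i))) => [i|j].
  have /qI[k [l [c [t [te qE]]]]] :
      radical (ideal_gen (fun g => exists i, g = q i)) (q i).
    by apply/radical_mem/ideal_gen_mem; exists i.
  have : (spec (q i) ^+ k)@_0%MM = 0.
    rewrite -specX qE spec_sum raddf_sum big1 //= => u _.
    have [a [b [ab ->]]] := te u; rewrite specM.
    by rewrite (rmorphM (mcoeff 0%MM)) /= spec_edge ?mulr0.
  rewrite (rmorphXn (mcoeff 0%MM)) /= => /eqP.
  by rewrite expf_eq0 => /andP[_ /eqP].
have jA : enum_val j \in [set: V] :\: A.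
  by have := enum_valP j; rewrite !inE andbT.
have [_ _ /(_ _ jA)[w wA jw]] := maxA.
have : radical (edge_ideal e) (vertex_var K (enum_val j) * vertex_var K w).
  by apply/radical_mem/ideal_gen_mem; exists (enum_val j), w.
move=> /qI[k [l [c [t [tq fE]]]]]; exists k, l, (spec \o c), (spec \o t).
split=> [u|]; first by have [i ti] := tq u; exists i; rewrite /= ti.
have := congr1 spec fE; rewrite specX specM spec_cover spec_ind // mulr1 =>
  ->; rewrite spec_sum.
by apply: eq_bigr => u _; rewrite specM.
Qed.

End Specialization.
End EdgeIdeals.

(** * Leaves of forests and resolutions of their edge ideals *)

Section Forests.
Variables (V : finType) (e : rel V).
Hypotheses (e_sym : ssrbool.symmetric e) (e_irr : irreflexive e).
Hypothesis e_forest : forest e.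
Implicit Types (S A : {set V}).
Local Notation nbrs := (nbrs e).

Lemma in_nbrs S u v : (u \in nbrs S v) = (u \in S) && e v u.
Proof. by rewrite inE. Qed.

Lemma e_neq u v : e u v -> u != v.
Proof. by apply: contraTneq => ->; rewrite e_irr. Qed.

(** If all degrees in [S] were at least 2, any path could be extended at its
    origin: a neighbour of the origin other than the next vertex cannot be on
    the path, as it would close a cycle. *)
Lemma forest_leaf S : S != set0 -> exists2 x, x \in S & (#|nbrs S x| <= 1)%N.
Proof.
move=> /set0Pn[x0 x0S].
apply/exists_inP; apply: contraT; rewrite negb_exists_in => /forall_inP noleaf.
have deg2 x : x \in S -> (1 < #|nbrs S x|)%N.
  by move=> /noleaf; rewrite -ltnNge.
have long k : exists x p, [/\ size p = k, path e x p, uniq (x :: p)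
    & all (mem S) (x :: p)].
  elim: k => [|k [x [p [pk px pu /= /andP[xS pS]]]]].
    by exists x0, [::]; split=> //=; rewrite x0S.
  have [u [uS xu uh]] : exists u, [/\ u \in S, e x u & u != head x p].
    have : (0 < #|nbrs S x :\ head x p|)%N.
      by have := cardsD1 (head x p) (nbrs S x); have := deg2 x xS; lia.
    by case/card_gt0P=> u; rewrite !inE => /and3P[? ? ?]; exists u.
  have [up | unp] := boolP (u \in p); last first.
    exists u, (x :: p) => /=; rewrite pk e_sym xu px; split=> //=.
      move: pu; rewrite /= inE negb_or unp => ->.
      by rewrite eq_sym (e_neq xu).
    by apply/and3P.
  case: p => // y p in px pu up uh pk pS *.
  rewrite inE (negPf uh) /= in up.
  case/splitPr: up => p1 p2 in px pu pk pS *.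
  have : ucycle e (x :: y :: rcons p1 u).
    rewrite /ucycle; apply/andP; split.
      move: px; rewrite /= cat_path /= => /and3P[-> p1y /andP[lu _]].
      by rewrite !rcons_path p1y lu last_rcons e_sym.
    apply: subseq_uniq pu; rewrite -cat_rcons -!cat_cons.
    exact: prefix_subseq.
  by move=> /e_forest /=; rewrite size_rcons.
have [x [p [pk _ /card_uniqP pu _]]] := long #|V|.
by have := max_card (mem (x :: p)); rewrite pu /= pk ltnn.
Qed.

Variable K : fieldType.
Local Notation edge_in := (edge_in e).
Local Notation maximal_independent := (maximal_independent e).
Local Notation has_res P p := (@has_resolution K #|V| P p).

(** The case of [has_resolution_cone] with [w = 0] adds a variable that divides
    no generator, and increases the length by 1 since the colon ideal is then
    the ideal itself. *)
Lemma has_resolution_variables S p (zs : seq V) :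
  uniq zs -> {in zs, forall z, z \notin S} -> has_res (edge_in S) p ->
  has_res (fun m => edge_in S m || has (fun z => 0 < m (enum_rank z))%N zs)
    (p + size zs).
Proof.
elim: zs => [|z zs IH] /= => [_ _|/andP[zzs uzs] zS resS].
  by rewrite addn0; apply: eq_has_resolution => m; rewrite orbF.
have {}IH := IH uzs (fun z' z'zs => zS z' (mem_behead (s := z ::
  zs) z'zs)) resS.
set P := (fun m => _ || _) in IH.
have upP : upset P.
  move=> m k /orP[mS|/hasP[z' z'zs mz']].
    by apply/orP; left; apply: upset_edge_in.
  by apply/orP; right; apply/hasP; exists z'; rewrite // mnmDE addn_gt0 mz'.
have nzd m : P (U_(enum_rank z) + m)%MM -> P m.
  have Uz u : u != z -> ((U_(enum_rank z) + m)%MM (enum_rank u) =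
    m (enum_rank u)).
    by move=> uz; rewrite mnmDE mnm1E (inj_eq enum_rank_inj) eq_sym (negPf uz).
  case/orP=> [/edge_inP[u [v [uS vS uv]]] | /hasP[z' z'zs]].
    have uz : u != z by apply: contraTneq uS => ->; apply: zS; rewrite mem_head.
    have vz : v != z by apply: contraTneq vS => ->; apply: zS; rewrite mem_head.
    rewrite !Uz // => mu mv; apply/orP; left; apply/edge_inP; by exists u, v.
  have z'z : z' != z by apply: contraNneq zzs => <-.
  by rewrite Uz // => mz'; apply/orP; right; apply/hasP; exists z'.
have IH' : has_res (fun m => P (0 + m)%MM) (p + size zs).
  by apply: eq_has_resolution IH => m; rewrite add0m.
have := has_resolution_cone upP nzd IH IH'.
rewrite -[in (size zs).+1]addn1 addnA addn1 (maxn_idPr (leqnSn _)).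
apply: eq_has_resolution => m; rewrite /P -orbA; congr (_ || _); rewrite orbC.
congr (_ || _); rewrite addm0; apply/mnm_lepP/idP => [/(_ (enum_rank z))|mz i].
  by rewrite mnm1E eqxx.
by rewrite mnm1E; case: eqP => [<-|].
Qed.

Lemma edge_in_isolated S x : nbrs S x = set0 -> edge_in (S :\ x) =1 edge_in S.
Proof.
move=> Nx m; apply/edge_inP/edge_inP => -[u [v [uS vS uv mu mv]]]; exists u, v.
  by case/setD1P: uS => _ ->; case/setD1P: vS => _ ->.
split=> //; rewrite !inE ?uS ?vS andbT; apply/eqP => x_eq; subst x.
  by have := in_nbrs S v u; rewrite Nx inE vS uv.
by have := in_nbrs S u v; rewrite Nx inE uS e_sym uv.
Qed.

Section Leaf.
Variables (S : {set V}) (x y : V).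
Hypotheses (xS : x \in S) (Nx : nbrs S x = [set y]).

Let yS : y \in S.
Proof. by have := set11 y; rewrite -Nx in_nbrs => /andP[]. Qed.
Let xy : e x y.
Proof. by have := set11 y; rewrite -Nx in_nbrs => /andP[]. Qed.
Let x_nbr v : v \in S -> e x v -> v = y.
Proof. by move=> vS xv; apply/set1P; rewrite -Nx in_nbrs vS. Qed.
Let S2 := S :\: (y |: nbrs S y).

Lemma edge_in_leaf :
  (fun m => edge_in (S :\ x) m || (U_(enum_rank x) + U_(enum_rank y) <= m)%MM)
  =1 edge_in S.
Proof.
move=> m; rewrite mnmU_le2 ?e_neq //; apply/idP/idP.
  case/orP=> [|/andP[mx my]]; last by apply/edge_inP; exists x, y.
  case/edge_inP=> u [v [/setD1P[_ uS] /setD1P[_ vS] uv mu mv]].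
  by apply/edge_inP; exists u, v.
case/edge_inP=> u [v [uS vS uv mu mv]].
have [ux | nux] := eqVneq u x.
  by rewrite -(x_nbr vS) -?ux ?uv ?mu ?mv ?orbT.
have [vx | nvx] := eqVneq v x.
  by rewrite -(x_nbr uS) -?vx 1?e_sym ?uv ?mu ?mv ?orbT.
apply/orP; left; apply/edge_inP; exists u, v.
by rewrite !inE nux nvx.
Qed.

(** The colon ideal of the edge ideal of [S - x] by [y]: the neighbours of [y]
    become generators, which makes all their edges redundant, and no other edge
    contains [y]. *)
Lemma edge_in_colon m : edge_in (S :\ x) (U_(enum_rank y) + m)%MM =
  edge_in S2 m || has (fun z => 0 < m (enum_rank z))%N (enum (nbrs S y :\ x)).
Proof.
have Uy u : u != y ->
    ((U_(enum_rank y) + m)%MM (enum_rank u) = m (enum_rank u)).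
  by move=> uy; rewrite mnmDE mnm1E (inj_eq enum_rank_inj) eq_sym (negPf uy).
apply/idP/idP.
  case/edge_inP=> u [v [uSx vSx uv]].
  have nbr_case w : w \in S :\ x -> e y w ->
      (0 < (U_(enum_rank y) + m)%MM (enum_rank w))%N ->
      has (fun z => 0 < m (enum_rank z))%N (enum (nbrs S y :\ x)).
    case/setD1P=> wx wS yw; rewrite Uy; last by rewrite eq_sym e_neq.
    by move=> mw; apply/hasP; exists w; rewrite // mem_enum !inE wx wS.
  have [yu mu mv | nyu] := boolP (e y u); first by rewrite (nbr_case u) ?orbT.
  have [yv mu mv | nyv] := boolP (e y v); first by rewrite (nbr_case v) ?orbT.
  have uy : u != y by apply: contraNneq nyv => <-.
  have vy : v != y by apply: contraNneq nyu => <-; rewrite e_sym.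
  rewrite !Uy // => mu mv; apply/orP; left; apply/edge_inP; exists u, v.
  case/setD1P: uSx => _ uS; case/setD1P: vSx => _ vS.
  by rewrite !inE uS vS !negb_or uy vy nyu nyv.
case/orP=> [/edge_inP[u [v [/setDP[uS uN] /setDP[vS vN] uv mu mv]]] | ].
  move: uN vN; rewrite !inE uS vS !negb_or => /andP[uy yu] /andP[vy yv].
  apply/edge_inP; exists u, v; rewrite !Uy // !inE uS vS !andbT; split=> //.
    by apply: contraNneq yu => ->; rewrite e_sym.
  by apply: contraNneq yv => ->; rewrite e_sym.
case/hasP=> z; rewrite mem_enum !inE => /and3P[zx zS yz] mz.
apply/edge_inP; exists y, z; rewrite !inE zx zS yS (Uy z); last first.
  by rewrite eq_sym e_neq.
by split=> //; [rewrite eq_sym e_neq | rewrite mnmDE mnm1E eqxx].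
Qed.

Lemma edge_in_leaf_nzd m :
  edge_in (S :\ x) (U_(enum_rank x) + m)%MM -> edge_in (S :\ x) m.
Proof.
case/edge_inP=> u [v [uS vS uv mu mv]]; apply/edge_inP; exists u, v; split=> //.
  move: mu; rewrite mnmDE mnm1E (inj_eq enum_rank_inj).
  by case/setD1P: uS => ux _; rewrite eq_sym (negPf ux).
move: mv; rewrite mnmDE mnm1E (inj_eq enum_rank_inj).
by case/setD1P: vS => vx _; rewrite eq_sym (negPf vx).
Qed.

(** The cone for the edge [xy]; the second resolution is that of the colon
    ideal, of length [p2 + #|nbrs S y| - 1]. *)
Lemma has_resolution_leaf p1 p2 :
  has_res (edge_in (S :\ x)) p1 -> has_res (edge_in S2) p2 ->
  has_res (edge_in S) (maxn p1 (p2 + #|nbrs S y|)).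
Proof.
move=> res1 res2; have xN : x \in nbrs S y by rewrite in_nbrs xS e_sym.
have := @has_resolution_variables S2 p2 (enum (nbrs S y :\ x)).
rewrite enum_uniq -cardE => /(_ isT) res2'.
have {}res2' := res2' _ res2.
have -> : (p2 + #|nbrs S y| = (p2 + #|nbrs S y :\ x|).+1)%N.
  by rewrite (cardsD1 x) xN addnA addn1 -addSn addnC addnS addnC.
apply: (eq_has_resolution edge_in_leaf).
apply: has_resolution_cone => //.
- exact: upset_edge_in.
- exact: edge_in_leaf_nzd.
apply: (eq_has_resolution (P := fun m => edge_in S2 m ||
   has (fun z => 0 < m (enum_rank z))%N (enum (nbrs S y :\ x)))).
  by move=> m; rewrite edge_in_colon.
apply: res2' => z; rewrite mem_enum !inE => /and3P[_ zS yz].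
by rewrite zS yz orbT.
Qed.

End Leaf.
End Forests.

(** * Minimal covers and the projective dimension of forests *)

Section Covers.
Variables (V : finType) (e : rel V).
Hypotheses (e_sym : ssrbool.symmetric e) (e_irr : irreflexive e).
Implicit Types (S A : {set V}).
Local Notation nbrs := (nbrs e).
Local Notation maximal_independent := (maximal_independent e).

Lemma card_star S y A : y \in S -> A \subset S :\: (y |: nbrs S y) ->
  #|S :\: (y |: A)| = (#|nbrs S y| + #|(S :\: (y |: nbrs S y)) :\: A|)%N.
Proof.
move=> yS /subsetP AS; rewrite -(cardsID (nbrs S y) (S :\: _)); congr (_ + _)%N.
  apply: eq_card => v; rewrite !inE;
    apply/idP/idP => [/andP[_ //]|/andP[vS yv]].
  rewrite vS yv !andbT negb_or eq_sym (e_neq e_irr yv) /=.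
  by apply/negP => /AS; rewrite !inE yv vS orbT.
apply: eq_card => v; rewrite !inE.
by case: (v \in S); case: (v \in A); case: (e y v); case: (v == y).
Qed.

(** With [maximal_independent_starK]: the maximal independent sets containing
    [y] are those of the graph without the closed neighbourhood of [y], plus
    [y]. *)
Lemma maximal_independent_star S y A : y \in S ->
  maximal_independent (S :\: (y |: nbrs S y)) A ->
  maximal_independent S (y |: A).
Proof.
move=> yS [AS indA maxA].
have nAy v : v \in A -> ~~ e y v.
  by move=> /(subsetP AS); rewrite !inE => /andP[+ vS];
    rewrite vS /= negb_or => /andP[].
split.
- by rewrite subUset sub1set yS (subset_trans AS) ?subsetDl.
- move=> u v /setU1P[->|uA] /setU1P[->|vA]; first by rewrite e_irr.
  + exact: nAy.
  + by rewrite e_sym nAy.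
  + exact: indA.
move=> v; rewrite !inE negb_or => /andP[/andP[vy vA] vS].
have [yv | nyv] := boolP (e y v); first by exists y;
  [exact: setU11 | rewrite e_sym].
have [|u uA vu] := maxA v; first by rewrite !inE vA vS negb_or vy nyv.
by exists u; rewrite // setU1r.
Qed.

Lemma maximal_independent_starK S y A : y \in A ->
  maximal_independent S A ->
  [/\ A :\ y \subset S :\: (y |: nbrs S y)
    & maximal_independent (S :\: (y |: nbrs S y)) (A :\ y)].
Proof.
move=> yA [AS indA maxA].
have sub : A :\ y \subset S :\: (y |: nbrs S y).
  apply/subsetP => v /setD1P[vy vA]; rewrite !inE negb_or vy (subsetP AS) //=.
  by rewrite indA.
split=> //; split=> // [u v /setD1P[_ uA] /setD1P[_ vA]|v]; first exact: indA.
rewrite !inE !negb_or negb_and => /andP[nvA /andP[/andP[vy +] vS]].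
rewrite vS /= => nyv; have [|u uA vu] := maxA v.
  by rewrite inE vS andbT; move: nvA; rewrite vy.
by exists u; rewrite // !inE uA andbT; apply: contraNneq nyv => <-;
  rewrite e_sym.
Qed.

Lemma maximal_independent_leaf S x y A : x \in S -> e x y -> y \in A ->
  maximal_independent (S :\ x) A ->
  maximal_independent S A /\ #|S :\: A| = #|(S :\ x) :\: A|.+1.
Proof.
move=> xS xy yA [AS indA maxA].
have xA : x \notin A by apply/negP => /(subsetP AS); rewrite !inE eqxx.
split; last by rewrite [LHS](cardsD1 x) !inE xA xS setDDl setUC -setDDl.
split=> //; first by apply: subset_trans AS (subsetDl _ _).
move=> v /setDP[vS vA]; have [->|vx] := eqVneq v x; first by exists y.
by apply: maxA; rewrite !inE vA vx.
Qed.

Lemma larger_cover_of_leaf S x y A : x \in S -> nbrs S x = [set y] ->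
  maximal_independent (S :\ x) A ->
  exists2 A', maximal_independent S A' & (#|(S :\ x) :\: A| <= #|S :\: A'|)%N.
Proof.
move=> xS Nx mA; have [yA | yA] := boolP (y \in A).
  have xy : e x y by have := set11 y; rewrite -Nx in_nbrs => /andP[].
  have [mA' cA'] := maximal_independent_leaf xS xy yA mA.
  by exists A; rewrite // cA'.
have [AS indA maxA] := mA.
have nAx v : v \in A -> ~~ e x v.
  move=> vA; apply: contra yA => xv.
  have : v \in nbrs S x by rewrite in_nbrs xv;
    move/(subsetP AS): vA => /setD1P[_ ->].
  by rewrite Nx inE => /eqP <-.
exists (x |: A); last by rewrite setDDl.
split; last 1 first.
- move=> v; rewrite -setDDl => /maxA[u uA vu].
  by exists u; rewrite // setU1r.
- by rewrite subUset sub1set xS (subset_trans AS) ?subsetDl.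
move=> u v /setU1P[->|uA] /setU1P[->|vA]; first by rewrite e_irr.
- exact: nAx.
- by rewrite e_sym nAx.
- exact: indA.
Qed.

(** If [A] contains the leaf [x] and [y] is dominated by [x] only, then
    exchanging [x] and [y] yields a maximal independent set of the same size
    containing [y]. *)
Lemma cover_of_leaf_cases S x y A : x \in S -> nbrs S x = [set y] ->
  maximal_independent S A ->
  (exists2 A1, maximal_independent (S :\ x) A1 &
     #|S :\: A| = #|(S :\ x) :\: A1|) \/
  (exists2 A2, maximal_independent (S :\: (y |: nbrs S y)) A2 &
     #|S :\: A| = (#|(S :\: (y |: nbrs S y)) :\: A2| + #|nbrs S y|)%N).
Proof.
move=> xS Nx mA.
have /andP[yS xy] : (y \in S) && e x y by rewrite -in_nbrs Nx inE.
have x_nbr v : v \in S -> e x v -> v = y.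
  by move=> vS xv; apply/set1P; rewrite -Nx in_nbrs vS.
have star B : maximal_independent S B -> y \in B ->
    exists2 A2, maximal_independent (S :\: (y |: nbrs S y)) A2 &
     #|S :\: B| = (#|(S :\: (y |: nbrs S y)) :\: A2| + #|nbrs S y|)%N.
  move=> mB yB; have [sB mB'] := maximal_independent_starK yB mB.
  by exists (B :\ y); rewrite // -{1}(setD1K yB) card_star // addnC.
have [yA | yA] := boolP (y \in A); first by right; apply: star.
have [AS indA maxA] := mA.
have xA : x \in A.
  apply: contraT => nxA; have [|u uA xu] := maxA x; first by rewrite inE nxA.
  by move: yA; rewrite -(x_nbr u) // ?uA //; apply: (subsetP AS).
have [/exists_inP[w wA yw] | /exists_inPn Ny] :=
    boolP [exists w in A :\ x, e y w].
  left; exists (A :\ x); last first.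
    by apply: eq_card => v; rewrite !inE; case: eqP => // ->; rewrite xA.
  split=> [|u v /setD1P[_ uA] /setD1P[_ vA]|v]; first exact: setSD.
    exact: indA.
  rewrite !inE => /andP[nvA /andP[vx vS]].
  have [->|vy] := eqVneq v y; first by exists w.
  have [|u uA vu] := maxA v; first by rewrite inE vS; move: nvA;
    rewrite vx => ->.
  exists u; rewrite // !inE uA andbT; apply: contraNneq vy => ux.
  by rewrite (x_nbr v) // -ux e_sym.
right; pose B := y |: (A :\ x).
have BS : B \subset S by rewrite subUset sub1set yS (subset_trans _ AS)
  ?subsetDl.
have -> : #|S :\: A| = #|S :\: B|.
  rewrite !cardsDS // /B cardsU1 !inE (negPf yA) andbF add1n.
  by rewrite (cardsD1 x A) xA.
apply: star; last exact: setU11.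
split=> // [u v /setU1P[->|uA] /setU1P[->|vA]|v].
- by rewrite e_irr.
- exact: Ny.
- by rewrite e_sym Ny.
- by case/setD1P: uA => _ uA; case/setD1P: vA => _ vA; apply: indA.
rewrite !inE negb_or => /andP[/andP[vy nvA] vS].
have [->|vx] := eqVneq v x; first by exists y; rewrite ?setU11.
have [|u uA vu] := maxA v; first by rewrite inE vS; move: nvA; rewrite vx => ->.
exists u; rewrite // !inE uA andbT; apply/orP; right.
by apply: contraNneq vy => ux; rewrite (x_nbr v) // -ux e_sym.
Qed.

Hypothesis e_forest : forest e.
Variable K : fieldType.
Local Notation has_res P p := (@has_resolution K #|V| P p).

(** The length of the resolution and the largest size of a minimal cover
    satisfy the same recursion on a leaf. *)
Lemma forest_resolution S : exists p, [/\ has_res (edge_in e S) p,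
  (exists2 A, maximal_independent S A & p <= #|S :\: A|)%N
  & forall A, maximal_independent S A -> (#|S :\: A| <= p)%N].
Proof.
have [m] := ubnP #|S|; elim: m S => // m IH S; rewrite ltnS => Sm.
have [-> | S0] := eqVneq S set0.
  exists 0%N; split=> [|  |A _]; last by rewrite set0D cards0.
    apply: eq_has_resolution (has_resolution0 _ _) => k.
    by apply/esym; case: edge_inP => // -[u [v []]]; rewrite inE.
  exists set0 => //.
  by split=> [|u v|v]; rewrite ?sub0set // ?inE // set0D inE.
have [x xS] := forest_leaf e_sym e_irr e_forest S0.
rewrite leq_eqVlt ltnS leqn0 cards_eq0 => /orP[/cards1P[y Nx]|/eqP Nx];
  last first.
  have Sx : S :\: (x |: nbrs S x) = S :\ x by rewrite Nx setU0.
  have [|p [resp [A mA pA] Ap]] := IH (S :\ x).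
    by move: Sm; rewrite (cardsD1 x) xS.
  exists p; split.
  - exact: eq_has_resolution (edge_in_isolated e_sym Nx) resp.
  - exists (x |: A); first by apply: maximal_independent_star; rewrite ?Sx.
    by rewrite -setDDl.
  move=> B mB; have xB : x \in B.
    apply: contraT => nxB; have [BS _ maxB] := mB.
    have [|u uB xu] := maxB x; first by rewrite inE nxB.
    by have := in_nbrs e S u x; rewrite Nx inE xu (subsetP BS).
  have [_ mB'] := maximal_independent_starK xB mB.
  by rewrite -(setD1K xB) -setDDl; apply: Ap; rewrite -Sx.
have [|p1 [res1 [A1 mA1 pA1] Ap1]] := IH (S :\ x).
  by move: Sm; rewrite (cardsD1 x) xS.
have /andP[yS xy] : (y \in S) && e x y by rewrite -in_nbrs Nx inE.
have [|p2 [res2 [A2 mA2 pA2] Ap2]] := IH (S :\: (y |: nbrs S y)).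
  apply: leq_trans (_ : #|S :\ y| < m)%N; last by move: Sm;
    rewrite (cardsD1 y) yS.
  by rewrite ltnS subset_leq_card // setDS // subsetUl.
exists (maxn p1 (p2 + #|nbrs S y|)); split.
- exact: (has_resolution_leaf e_sym e_irr xS Nx).
- case: leqP => _.
    exists (y |: A2); first exact: maximal_independent_star.
    have [sA2 _ _] := mA2.
    by rewrite (card_star yS sA2) addnC leq_add2l.
  have [A mA cA] := larger_cover_of_leaf xS Nx mA1.
  by exists A; rewrite // (leq_trans pA1).
move=> A /(cover_of_leaf_cases xS Nx)[] [B mB ->]; rewrite leq_max.
  by rewrite Ap1.
by rewrite leq_add2r Ap2 ?orbT.
Qed.

End Covers.

(** * Tree-like systems on sets of edges *)

Section EdgeChains.
Variables (V : finType) (e : rel V).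
Hypotheses (e_sym : ssrbool.symmetric e) (e_irr : irreflexive e).
Implicit Types (S A D E : {set V}).
Local Notation nbrs := (nbrs e).
Local Notation maximal_independent := (maximal_independent e).
Local Notation entry := ({set V} * option {set V})%type.
Implicit Types (l c : seq entry).

(** A tree-like system whose summands are edge monomials, listed from its last
    element to its first: the entry [(a, Some b)] stands for the sum of the
    monomials of [a] and [b], the entry [(a, None)] for the monomial of [a].
    The monomial of [x.1] divides the product of those of [a] and [b] when
    [x.1] is contained in their union. The first element of the system, having
    no predecessor, is necessarily a single monomial. *)
Fixpoint tree_chain l : bool :=
  if l is (a, ob) :: l' then
    (if ob is Some b then has (fun x : entry => x.1 \subset a :|:
      b) l' else true)
    && tree_chain l'
  else true.

Definition edges_of l : seq {set V} :=
  flatten [seq x.1 :: seq_of_opt x.2 | x <- l].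

Definition is_edge S E :=
  exists u v, [/\ u \in S, v \in S, e u v & E = [set u; v]].

(** The last two conditions make the length of the system the size of a minimal
    cover, hence optimal. *)
Definition chain_of S l A := [/\ tree_chain l, uniq (edges_of l),
  forall E, E \in edges_of l <-> is_edge S E,
  maximal_independent S A & size l = #|S :\: A|].

Lemma edges_of_cat c l : edges_of (c ++ l) = edges_of c ++ edges_of l.
Proof. by rewrite /edges_of map_cat flatten_cat. Qed.

Lemma tree_chain_cat c l : tree_chain c -> tree_chain l -> tree_chain (c ++ l).
Proof.
elim: c => [|[a ob] c IH] //= /andP[ha /IH hc] /hc ->; rewrite andbT.
by case: ob ha => // b; rewrite has_cat => ->.
Qed.

Lemma is_edge_setD S D E : is_edge S E <-> is_edge (S :\: D) E \/
  exists u v, [/\ u \in D, u \in S, v \in nbrs S u & E = [set u; v]].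
Proof.
split=> [[u [v [uS vS uv ->]]]|[[u [v [/setDP[uS _] /setDP[vS _] uv ->]]]|]].
- have [uD|uD] := boolP (u \in D).
    by right; exists u, v; rewrite in_nbrs vS.
  have [vD|vD] := boolP (v \in D).
    by right; exists v, u; rewrite in_nbrs uS e_sym uv setUC.
  by left; exists u, v; rewrite !inE uD vD.
- by exists u, v.
by case=> u [v [_ uS]]; rewrite in_nbrs => /andP[vS uv ->]; exists u, v.
Qed.

Lemma edges_extend S D (s t : seq {set V}) :
  uniq s -> uniq t -> (forall E, E \in t <-> is_edge (S :\: D) E) ->
  (forall u v, u \in D -> u \in S -> v \in nbrs S u -> [set u; v] \in s) ->
  (forall E, E \in s -> exists u v,
     [/\ u \in D, u \in S, v \in nbrs S u & E = [set u; v]]) ->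
  uniq (s ++ t) /\ (forall E, E \in s ++ t <-> is_edge S E).
Proof.
move=> us ut tE sD Ds; split.
  rewrite cat_uniq us ut andbT; apply/hasPn => E /tE[u [v [uSD vSD _ ->]]].
  apply/negP => /Ds[a [b [aD _ _]]] /setP/(_ a); rewrite set21 => /set2P[] ax.
    by move: uSD; rewrite -ax inE aD.
  by move: vSD; rewrite -ax inE aD.
move=> E; rewrite mem_cat; split=> [/orP[/Ds sE|/tE sE]|].
- by apply/(is_edge_setD S D); right.
- by apply/(is_edge_setD S D); left.
case/(is_edge_setD S D)=> [/tE->|[u [v [uD uS vu ->]]]]; first by rewrite orbT.
by rewrite sD.
Qed.

(** Removing a closed neighbourhood N[y] decreases the size of the cover by
    [#|N(y)|], so the edges meeting N[y] have to be arranged in this number of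
    entries. *)
Lemma chain_star S y l c A : y \in S ->
  chain_of (S :\: (y |: nbrs S y)) l A ->
  tree_chain c -> uniq (edges_of c) -> size c = #|nbrs S y| ->
  (forall u v, u \in y |: nbrs S y -> v \in nbrs S u ->
     [set u; v] \in edges_of c) ->
  (forall E, E \in edges_of c -> exists u v,
     [/\ u \in y |: nbrs S y, v \in nbrs S u & E = [set u; v]]) ->
  chain_of S (c ++ l) (y |: A).
Proof.
move=> yS [tl ul lE mA sl] tc uc sc cE Ec.
have NS u : u \in y |: nbrs S y -> u \in S.
  by case/setU1P=> [->//|]; rewrite in_nbrs => /andP[].
rewrite /chain_of edges_of_cat.
have [||uE lE'] := edges_extend uc ul lE; first by move=> u v uD _; apply: cE.
  move=> E /Ec[u [v [uD vu ->]]]; exists u, v; split=> //; exact: NS.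
split=> //.
- exact: tree_chain_cat.
- exact: maximal_independent_star.
- have [AS _ _] := mA; by rewrite size_cat sc sl (card_star e_irr).
Qed.

(** A single entry [a] at [z] leaves room for a second summand: an edge [xy]
    may be added to it if an edge [zy] is put before it in the system. *)
Definition has_single z l := exists2 a, (a, None) \in l & z \in a.

Lemma set2_inj (a b d : V) : [set a; b] = [set a; d] -> b = d.
Proof.
move/setP=> E; have := E b; have := E d; rewrite !inE !eqxx !orbT.
by case: eqP => [->|_] /=; [move=> _ /esym/orP[]/eqP | move=> /eqP].
Qed.

Lemma set2_notin (a b d f : V) : a != d -> a != f -> [set a; b] != [set d; f].
Proof.
move=> ad af; apply/eqP => /setP/(_ a).
by rewrite !inE eqxx (negPf ad) (negPf af).
Qed.

Lemma chain_star1 S y u l A : y \in S ->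
  nbrs S y = [set u] -> nbrs S u = [set y] ->
  chain_of (S :\: (y |: nbrs S y)) l A ->
  chain_of S (([set y; u], None) :: l) (y |: A).
Proof.
move=> yS Ny Nu ch; apply: (chain_star yS (c := [:: ([set y;
  u], None)]) ch) => //.
- by rewrite Ny cards1.
- rewrite Ny => a b /set2P[] ->; rewrite ?Ny ?Nu => /set1P ->; rewrite inE //.
  by rewrite setUC.
- move=> E; rewrite inE => /eqP ->; exists y, u.
  by rewrite setU11 Ny set11.
Qed.

(** This is where stretchedness is used: the three edges around [y] and [w]
    form two entries only, as [yu * ww'] is a multiple of [yw], and the cover
    grows by two vertices. A further edge at [w] would need an entry of its
    own. *)
Lemma chain_star2 S y u w (o : option V) l A : y \in S -> u != w ->
  nbrs S y = [set u; w] -> nbrs S u = [set y] ->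
  nbrs S w = y |: oapp (fun w' => [set w']) set0 o -> o != Some y ->
  chain_of (S :\: (y |: nbrs S y)) l A ->
  chain_of S (([set y; u], omap (fun w' => [set w; w']) o)
              :: ([set y; w], None) :: l) (y |: A).
Proof.
move=> yS uw Ny Nu Nw oy ch.
have yu : y != u.
  have : y \in nbrs S u by rewrite Nu set11.
  by rewrite in_nbrs => /andP[_ /(e_neq e_irr)]; rewrite eq_sym.
have yw : y != w.
  have : y \in nbrs S w by rewrite Nw setU11.
  by rewrite in_nbrs => /andP[_ /(e_neq e_irr)]; rewrite eq_sym.
have yu_yw : [set y; u] != [set y; w].
  by apply/eqP => /set2_inj/eqP; apply/negP.
apply: (chain_star yS (c := [:: _; _]) ch) => //.
- case: o {Nw oy} => //= w'; rewrite orbF andbT.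
  by rewrite subUset !sub1set !inE !eqxx ?orbT.
- case: o oy Nw => [w'|_ _] /=; last by rewrite inE yu_yw.
  move=> wy' Nw; have yw' : y != w' by apply: contraNneq wy' => ->.
  by rewrite !inE (negPf yu_yw) orbF set2_notin //= eq_sym set2_notin.
- by rewrite Ny cards2 uw.
- move=> a b /setU1P[->|]; rewrite Ny.
    by case/set2P=> ->; case: o {Nw oy} => [w'|] /=; rewrite !inE eqxx ?orbT.
  case/set2P=> ->; first by rewrite Nu => /set1P ->; rewrite setUC inE eqxx.
  rewrite Nw; case: o {Nw oy} => [w'|] /=; last first.
    by rewrite setU0 => /set1P ->; rewrite setUC !inE eqxx orbT.
  by case/set2P=> ->; rewrite ?[[set w; y]]setUC !inE eqxx ?orbT.
- have yu_ok : exists a b, [/\ a \in y |: nbrs S y, b \in nbrs S a &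
      [set y; u] = [set a; b]].
    by exists y, u; rewrite setU11 Ny set21.
  have yw_ok : exists a b, [/\ a \in y |: nbrs S y, b \in nbrs S a &
      [set y; w] = [set a; b]].
    by exists y, w; rewrite setU11 Ny set22.
  case: o Nw {oy} => [w'|] Nw E /=; rewrite !inE => /orP[/eqP->//|].
    case/orP=> /eqP-> //; exists w, w'.
    by rewrite Ny Nw !inE !eqxx !orbT.
  by move=> /eqP->.
Qed.

(** When [z] is in [A], each additional leaf [u] at [z] enlarges the cover,
    which pays for a new single entry. *)
Lemma chain_leaf S z u l A : u \in S -> nbrs S u = [set z] -> z \in A ->
  chain_of (S :\ u) l A -> chain_of S (([set z; u], None) :: l) A.
Proof.
move=> uS Nu zA [tl ul lE mA sl].
have uz : e u z.
  by have := set11 z; rewrite -Nu in_nbrs => /andP[].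
have [mA' cA] := maximal_independent_leaf uS uz zA mA.
have [|||uE lE'] := edges_extend (s := [:: [set z; u]]) _ ul lE => //.
- by move=> a b /set1P -> _; rewrite Nu => /set1P ->; rewrite setUC inE.
- move=> E; rewrite inE => /eqP ->; exists u, z.
  by rewrite set11 uS Nu set11 setUC.
by split; rewrite //= sl cA.
Qed.

(** A pendant path [z - y - x] enlarges the cover by one vertex only, so its
    two edges must cost one entry: [xy] joins the single entry [a] at [z], the
    new single entry [zy] coming just before it, since [a * xy] is a multiple
    of [zy]. The new entry is again single at [z]. *)
Lemma chain_tail S x y z l A : x \in S -> x != z ->
  nbrs S x = [set y] -> nbrs S y = [set x; z] ->
  chain_of (S :\: (x |: nbrs S x)) l A -> has_single z l ->
  exists2 l', chain_of S l' (x |: A) & has_single z l'.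
Proof.
move=> xS xz Nx Ny [tl ul lE mA sl] [a al za].
have yz : y != z.
  have : z \in nbrs S y by rewrite Ny set22.
  by rewrite in_nbrs => /andP[_ /(e_neq e_irr)].
have yx : y != x.
  have : x \in nbrs S y by rewrite Ny set21.
  by rewrite in_nbrs => /andP[_ /(e_neq e_irr)].
case/splitPr: al tl ul lE sl => l1 l2 tl ul lE sl.
pose l' := l1 ++ (a, Some [set x; y]) :: ([set z; y], None) :: l2.
exists l'; last by exists [set z; y]; rewrite ?set21 // mem_cat !inE eqxx !orbT.
have perm_l' : perm_eq (edges_of l')
    ([:: [set x; y]; [set z; y]] ++ edges_of (l1 ++ (a, None) :: l2)).
  rewrite /l' !edges_of_cat /=.
  rewrite -[edges_of ((a, Some _) :: _)]/
    ([:: a; [set x; y]; [set z; y]] ++ edges_of l2).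
  rewrite -[edges_of ((a, None) :: _)]/([:: a] ++ edges_of l2).
  by apply/permP => P; rewrite /= !count_cat /=; lia.
have [|||uE lE'] := edges_extend (s := [:: [set x; y]; [set z; y]]) _ ul lE.
- by rewrite /= inE set2_notin // eq_sym.
- rewrite Nx => b d /set2P[]-> _; rewrite ?Nx ?Ny.
    by move=> /set1P->; rewrite inE eqxx.
  by case/set2P=> ->; rewrite setUC !inE eqxx ?orbT.
- have yS : y \in S.
    by have := set11 y; rewrite -Nx in_nbrs => /andP[].
  move=> E; rewrite !inE => /orP[]/eqP->.
    by exists x, y; rewrite setU11 Nx set11.
  by exists y, z; rewrite Nx set22 yS Ny set22 setUC.
have [AS _ _] := mA.
split.
- move: tl; rewrite /l' {sl perm_l' uE lE' ul lE l'}.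
  elim: l1 => [|[b ob] l1 IH] /=.
    by move=> ->; rewrite andbT subUset !sub1set !inE za eqxx !orbT.
  case/andP=> hb /IH ->; rewrite andbT; case: ob hb => // b'.
  by rewrite !has_cat /= => /or3P[->|->|->]; rewrite ?orbT.
- by rewrite (perm_uniq perm_l').
- by move=> E; rewrite (perm_mem perm_l').
- exact: maximal_independent_star.
- rewrite (card_star e_irr) // -sl Nx cards1 /l' !size_cat /=; lia.
Qed.

End EdgeChains.

(** * Tree-like systems of stretched forests *)

Section StretchedForests.
Variables (V : finType) (e : rel V).
Hypotheses (e_sym : ssrbool.symmetric e) (e_irr : irreflexive e).
Implicit Types (S A D E W : {set V}).
Local Notation nbrs := (nbrs e).
Local Notation chain_of := (chain_of e).

Lemma nbrs_setD S D v : nbrs (S :\: D) v = nbrs S v :\: D.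
Proof. by apply/setP => u; rewrite !inE andbA. Qed.

Lemma nbrs_mem S u v : v \in S -> u \in nbrs S v -> v \in nbrs S u.
Proof. by rewrite !in_nbrs e_sym => -> /andP[]. Qed.

Lemma nbrs_neq S u v : u \in nbrs S v -> u != v.
Proof. by rewrite in_nbrs eq_sym => /andP[_ /(e_neq e_irr)]. Qed.

Lemma card_le1 (T : finType) (W : {set T}) :
  (#|W| <= 1)%N -> exists o, W = oapp (fun w => [set w]) set0 o.
Proof.
rewrite leq_eqVlt ltnS leqn0 cards_eq0 => /orP[/cards1P[w ->]|/eqP->].
  by exists (Some w).
by exists None.
Qed.

Definition leaf_at S z y := nbrs S y = [set z].

Definition tail_at S z y x :=
  [/\ x != z, nbrs S y = [set x; z] & nbrs S x = [set y]].

(** [W] contains the only possible neighbour of [z] that is neither a leaf nor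
    the middle of a pendant path. The last condition follows from stretchedness
    for the centres found by [exists_centre], and is stable under the removal
    of leaves and pendant paths, in contrast to the degree of [z]. *)
Definition centre S z W := [/\ z \in S, W \subset nbrs S z, (#|W| <= 1)%N,
  forall y, y \in nbrs S z :\: W -> leaf_at S z y \/ exists x, tail_at S z y x
  & forall u w, u \in nbrs S z :\: W -> leaf_at S z u -> w \in W ->
      (#|nbrs S w| <= 2)%N].

Section Centre.
Variable m : nat.
Hypothesis smaller : forall S, (#|S| < m)%N -> exists l A, chain_of S l A.

Let smaller_star S y : (#|S| <= m)%N -> y \in S ->
  exists l A, chain_of (S :\: (y |: nbrs S y)) l A.
Proof.
move=> Sm yS; apply: smaller; apply: leq_trans Sm.
apply: (@leq_ltn_trans #|S :\ y|); last by rewrite [ltnRHS](cardsD1 y) yS.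
by rewrite subset_leq_card // setDS // subsetUl.
Qed.

(** Pendant paths, then leaves, are removed one at a time and put back by
    [chain_tail] and [chain_leaf]. When one of them is left, [chain_star2] or
    [chain_star1] applies around [z] if it is a leaf, and around the middle of
    the path, with the roles of [y] and [w] played by that vertex and [z], if
    it is a pendant path. The presence of a leaf forces [z] into the
    independent set, as [chain_leaf] requires. *)
Lemma centre_chain S z W : (#|S| <= m)%N -> centre S z W ->
  nbrs S z :\: W != set0 ->
  exists l A, [/\ chain_of S l A, has_single z l &
    forall u, u \in nbrs S z :\: W -> leaf_at S z u -> z \in A].
Proof.
have [k] := ubnP #|S|; elim: k S W => // k IH S W; rewrite ltnS => Sk Sm.
case=> zS WN W1 lt deg2 /set0Pn[y0 y0N].
have zy y : y \in nbrs S z -> z \in nbrs S y by apply: nbrs_mem.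
have NS v u : u \in nbrs S v -> u \in S by rewrite in_nbrs => /andP[].
have [/exists_inP[y yNW nly] | /exists_inPn all_leaf] :=
    boolP [exists y in nbrs S z :\: W, nbrs S y != [set z]].
  have [yN yW] : y \in nbrs S z /\ y \notin W by case/setDP: yNW.
  have [ly|[x [xz Ny Nx]]] := lt y yNW; first by rewrite /leaf_at in ly;
    rewrite ly eqxx in nly.
  have xS : x \in S by apply: (NS y); rewrite Ny set21.
  have [Y1 | /set0Pn[y2]] := eqVneq (nbrs S z :\: W :\ y) set0.
    have onlyy v : v \in nbrs S z :\: W -> v = y.
      move=> vN; apply/eqP; apply: contraT => vy.
      by have := in_set0 v; rewrite -Y1 inE vN inE vy.
    have [o Wo] := card_le1 W1.
    have yS := NS _ _ yN.
    have [l [A ch]] := smaller_star Sm yS.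
    have Nz : nbrs S z = y |: oapp (fun w' => [set w']) set0 o.
      rewrite -Wo; apply/setP => v; rewrite in_setU1.
      have [->|vy] := eqVneq v y; first by rewrite yN.
      apply/idP/idP => [vN|/(subsetP WN)//]; apply: contraT => vW.
      by rewrite (onlyy v) ?eqxx // in_setD vW in vy.
    have oy : o != Some y.
      by apply: contraNneq yW => oy; rewrite Wo oy set11.
    do 2!eexists; split.
    - exact: (chain_star2 e_sym e_irr yS xz Ny Nx Nz oy ch).
    - by exists [set y; z]; rewrite ?set22 // !inE eqxx orbT.
    - by move=> u /onlyy -> ly; rewrite ly eqxx in nly.
  case/setD1P=> y2y y2N.
  set S' := S :\: (x |: nbrs S x).
  have N' v : nbrs S' v = nbrs S v :\: [set x; y] by rewrite nbrs_setD Nx.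
  have zx : z \notin [set x; y].
    by rewrite !inE negb_or eq_sym xz eq_sym (nbrs_neq yN).
  have xNz : x \notin nbrs S z.
    by apply: contraNN zx => /zy; rewrite Nx !inE => /eqP->; rewrite eqxx orbT.
  have xW : x \notin W by apply: contraNN xNz => /(subsetP WN).
  have N'z v : (v \in nbrs S' z :\: W) = (v != y) && (v \in nbrs S z :\: W).
    rewrite N' !in_setD !in_set2 negb_or.
    have [-> | //] := eqVneq v x; last by case: (v \in W); rewrite ?andbF.
    by rewrite (negPf xNz) !andbF.
  have leaf' u : u \in nbrs S z :\: W -> u != y ->
      leaf_at S' z u -> leaf_at S z u.
    move=> uN uy; have [//|[x' [x'z Nu Nx']]] := lt u uN.
    rewrite /leaf_at N' Nu => /setP/(_ x'); rewrite !inE eqxx (negPf x'z).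
    rewrite andbT => /negbFE /orP[] /eqP x'E.
      by rewrite x'E Nx in Nx'; rewrite (set1_inj Nx') eqxx in uy.
    rewrite x'E Ny in Nx'; have := set21 x z; rewrite Nx' => /set1P xu.
    by have := set22 x z; rewrite Nx' => /set1P zu; rewrite xu zu eqxx in xz.
  have [||||l [A [ch sg zA]]] := IH S' W.
  - apply: leq_trans Sk; rewrite [ltnRHS](cardsD1 x) xS ltnS.
    by rewrite subset_leq_card // setDS // subsetUl.
  - by apply: leq_trans Sm; rewrite subset_leq_card ?subsetDl.
  - split=> //; first by rewrite in_setD zS Nx andbT.
    + apply/subsetP => w wW; rewrite N' in_setD (subsetP WN) // andbT !inE
      negb_or.
      by apply/andP; split; apply: contraTneq wW => ->.
    + move=> v; rewrite N'z => /andP[vy vN].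
      have [lv|[x' [x'z Nv Nx']]] := lt v vN.
        left; rewrite /leaf_at N' lv; apply/setP => t; rewrite in_setD.
        rewrite [t \in [set z]]inE.
        by have [->|//] := eqVneq t z; rewrite ?zx ?andbF.
      right; exists x'.
      have x'xy : x' \notin [set x; y].
        rewrite !inE negb_or; apply/andP; split; apply/eqP => x'E.
          by rewrite x'E Nx in Nx'; rewrite (set1_inj Nx') eqxx in vy.
        rewrite x'E Ny in Nx'; have := set21 x z; rewrite Nx' => /set1P xu.
        by have := set22 x z; rewrite Nx' => /set1P zu;
          rewrite xu zu eqxx in xz.
      have vxy : v \notin [set x; y].
        rewrite !inE negb_or vy andbT; apply: contraNneq xNz => <-.
        by case/setDP: vN.
      split=> //; rewrite N' ?Nv ?Nx'; apply/setDidPl; rewrite disjoint_subset.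
        by apply/subsetP => t /set2P[]->; rewrite inE /=.
      by apply/subsetP => t /set1P->; rewrite inE /=.
    + move=> u w; rewrite N'z => /andP[uy uN] /(leaf' _ uN uy) lu wW.
      by apply: leq_trans (deg2 u w uN lu wW);
        rewrite N' subset_leq_card ?subsetDl.
  - by apply/set0Pn; exists y2; rewrite N'z y2y y2N.
  have [l' ch' sg'] := chain_tail e_sym e_irr xS xz Nx Ny ch sg.
  exists l', (x |: A); split=> // u uN lu.
  have uy : u != y by apply: contraNneq nly => <-; apply/eqP.
  rewrite setU1r // (zA u) ?N'z ?uy //.
  rewrite /leaf_at N' lu; apply/setP => t; rewrite in_setD [t \in [set z]]inE.
  by have [->|//] := eqVneq t z; rewrite ?zx ?andbF.
have leafE u : u \in nbrs S z :\: W -> nbrs S u = [set z].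
  by move=> /all_leaf; rewrite negbK => /eqP.
have [Y1 | /set0Pn[u2]] := eqVneq (nbrs S z :\: W :\ y0) set0.
  have [l [A ch]] := smaller_star Sm zS.
  have Nu := leafE _ y0N; case/setDP: (y0N) => y0z y0W.
  have Nz : nbrs S z = y0 |: W.
    apply/setP => v; rewrite in_setU1.
    have [->|vy] := eqVneq v y0; first by rewrite y0z.
    apply/idP/idP => [vN|/(subsetP WN)//]; apply: contraT => vW.
    by have := in_set0 v; rewrite -Y1 !inE vy vW -in_nbrs vN.
  have [[w|] /= Wo] := card_le1 W1; last first.
    rewrite Wo setU0 in Nz; do 2!eexists; split.
    - exact: (chain_star1 e_sym e_irr zS Nz Nu ch).
    - by exists [set z; y0]; rewrite ?set21 // mem_head.
    - by rewrite setU11.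
  rewrite Wo in Nz.
  have wz : w \in nbrs S z by rewrite Nz set22.
  have y0w : y0 != w by apply: contraNneq y0W => ->; rewrite Wo set11.
  have : (#|nbrs S w :\ z| <= 1)%N.
    have := deg2 y0 w y0N Nu; rewrite Wo set11 => /(_ isT).
    by rewrite (cardsD1 z) zy.
  case/card_le1=> o oE.
  have Nw : nbrs S w = z |: oapp (fun w' => [set w']) set0 o.
    by rewrite -oE setD1K // zy.
  have oz : o != Some z.
    by apply/eqP => oz; have := set11 z; rewrite oz /= in oE;
      rewrite -oE !inE eqxx.
  do 2!eexists; split.
  - exact: (chain_star2 e_sym e_irr zS y0w Nz Nu Nw oz ch).
  - by exists [set z; w]; rewrite ?set21 // !inE eqxx orbT.
  - by rewrite setU11.
case/setD1P=> u2y u2N; case/setDP: (y0N) => y0z y0W.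
have Nu := leafE _ y0N.
have N' v : nbrs (S :\ y0) v = nbrs S v :\ y0 by rewrite nbrs_setD.
have leaf' u : u \in nbrs S z :\: W -> nbrs (S :\ y0) u = [set z].
  move=> /leafE; rewrite N' => ->; apply/setP => t; rewrite !inE.
  by have [->|] := eqVneq t z; rewrite ?andbF // eq_sym (nbrs_neq y0z).
have N'z v :
    (v \in nbrs (S :\ y0) z :\: W) = (v != y0) && (v \in nbrs S z :\: W).
  by rewrite N' !in_setD in_set1 andbCA.
have y0S := NS _ _ y0z.
have [||||l [A [ch sg zA]]] := IH (S :\ y0) W.
- by apply: leq_trans Sk; rewrite [ltnRHS](cardsD1 y0) y0S.
- by apply: leq_trans Sm; rewrite subset_leq_card ?subsetDl.
- split=> //; first by rewrite in_setD1 zS eq_sym (nbrs_neq y0z).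
  + apply/subsetP => w wW; rewrite N' in_setD1 (subsetP WN) // andbT.
    by apply: contraNneq y0W => <-.
  + by move=> v; rewrite N'z => /andP[_ /leaf']; left.
  + move=> u w; rewrite N'z => /andP[_ uN] _ wW.
    apply: leq_trans (deg2 u w uN (leafE _ uN) wW).
    by rewrite N' subset_leq_card ?subsetDl.
- by apply/set0Pn; exists u2; rewrite N'z u2y u2N.
have {}zA : z \in A by apply: (zA u2); rewrite ?N'z ?u2y //; apply: leaf'.
exists (([set z; y0], None) :: l), A; split=> //.
  exact: chain_leaf.
by exists [set z; y0]; rewrite ?set21 // mem_head.
Qed.

End Centre.

Hypothesis e_forest : forest e.
Hypothesis e_stretched : stretched e.

Let tailed S v := (#|nbrs S v| == 2) && [exists x in nbrs S v,
  #|nbrs S x| == 1%N].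

Let tailed_tail S z y : tailed S y -> z \in S -> y \in nbrs S z ->
  (#|nbrs S z| != 1)%N -> exists x, tail_at S z y x.
Proof.
case/andP=> y2 /exists_inP[x xN x1] zS yN z1; exists x.
have xz : x != z by apply: contraNneq z1 => <-.
have zN := nbrs_mem zS yN.
have yS : y \in S by move: yN; rewrite in_nbrs => /andP[].
split=> //.
  apply/esym/eqP; rewrite eqEcard cards2 xz (eqP y2) andbT.
  by apply/subsetP => t /set2P[]->.
case/cards1P: x1 => t Nx; have := nbrs_mem yS xN.
by rewrite Nx => /set1P->.
Qed.

Lemma leaf_le1 S z y : z \in S -> y \in nbrs S z -> (#|nbrs S y| <= 1)%N ->
  leaf_at S z y.
Proof.
move=> zS yN y1; apply/esym/eqP; rewrite eqEcard cards1 y1 andbT sub1set.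
exact: nbrs_mem.
Qed.

(** A centre is a vertex of degree at most 1 in the forest left after deleting
    the leaves and the middles of pendant paths. If all vertices get deleted,
    every component is a path with at most 4 vertices; the middle of a pendant
    path is then chosen if there is one, as an end of a path with at least 3
    vertices would see its neighbour as a pendant path through itself. *)
Lemma exists_centre S : (exists E, is_edge e S E) ->
  exists z W, centre S z W /\ nbrs S z :\: W != set0.
Proof.
case=> E [a [b [aS bS ab _]]].
pose S' := [set v in S | (1 < #|nbrs S v|)%N && ~~ tailed S v].
have outS' y : y \in S -> y \notin S' -> (#|nbrs S y| <= 1)%N || tailed S y.
  by move=> yS; rewrite inE yS /= negb_and negbK -leqNgt.
have [S'0 | /(forest_leaf e_sym e_irr e_forest)[z zS' z1]] := eqVneq S' set0.
  (* The degree of [z] excludes [z] itself as the end of a pendant path. *)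
  have [z [zS z0 zt]] : exists z, [/\ z \in S, nbrs S z != set0 &
      forall y, y \in S -> tailed S y -> #|nbrs S z| != 1%N].
    have [/exists_inP[z zS tz] | /exists_inPn nt] :=
        boolP [exists z in S, tailed S z].
      exists z; have /eqP z2 : #|nbrs S z| == 2 by case/andP: tz.
      by split=> //; rewrite ?z2 // -cards_eq0 z2.
    exists a; split=> //; first by apply/set0Pn; exists b; rewrite in_nbrs bS.
    by move=> y /nt/negPf->.
  exists z, set0; split; last by rewrite setD0.
  split; rewrite ?sub0set ?cards0 //; last by move=> u w _ _; rewrite inE.
  move=> y; rewrite setD0 => yN; have yS : y \in S by move: yN;
    rewrite in_nbrs => /andP[].
  have /(outS' y yS)/orP[y1|ty] : y \notin S' by rewrite S'0 inE.
    by left; apply: leaf_le1.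
  by right; apply: tailed_tail => //; apply: zt yS ty.
exists z, (nbrs S' z); move: (zS'); rewrite inE => /and3P[zS z2 ntz].
split; last first.
  rewrite -card_gt0 cardsDS ?subn_gt0 ?(leq_ltn_trans z1) //.
  by apply/subsetP => t; rewrite !in_nbrs inE => /andP[/and3P[-> _ _] ->].
split=> //.
- by apply/subsetP => t; rewrite !in_nbrs inE => /andP[/and3P[-> _ _] ->].
- move=> y /setDP[yN yN']; have [yS zy] : y \in S /\ e z y.
    by move: yN; rewrite in_nbrs => /andP[].
  have nyS' : y \notin S' by apply: contra yN' => yS'; rewrite in_nbrs yS'.
  have /orP[y1|ty] := outS' y yS nyS'.
    by left; apply: leaf_le1.
  by right; apply: tailed_tail => //; rewrite neq_ltn z2 orbT.
- move=> u w /setDP[uN _] lu; rewrite in_nbrs inE => /andP[/andP[wS _] zw].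
  have le_deg v : (#|nbrs S v| <= degree e v)%N.
    by apply: subset_leq_card; apply/subsetP => t; rewrite !inE => /andP[].
  have /orP[dz|/(leq_trans (le_deg w))//] := e_stretched zw.
  case/negP: ntz; rewrite /tailed eqn_leq z2 (leq_trans (le_deg z)) //=.
  by apply/exists_inP; exists u; rewrite // lu cards1.
Qed.

Lemma stretched_forest_chain S : exists l A, chain_of S l A.
Proof.
have [m] := ubnP #|S|; elim: m S => // m IH S; rewrite ltnS => Sm.
have [/exists_inP[a aS /exists_inP[b bS ab]] | noedge] :=
    boolP [exists a in S, exists b in S, e a b].
  have [|z [W [cW W0]]] := @exists_centre S.
    by exists [set a; b], a, b.
  by have [l [A []]] := centre_chain IH Sm cW W0; exists l, A.
have {}noedge u v : u \in S -> v \in S -> ~~ e u v.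
  move=> uS vS; apply: contra noedge => uv; apply/exists_inP; exists u => //.
  by apply/exists_inP; exists v.
exists [::], S; split=> //; last by rewrite setDv cards0.
  move=> E; split=> // -[u [v [uS vS uv _]]].
  by rewrite (negPf (noedge u v uS vS)) in uv.
by split=> // v; rewrite setDv inE.
Qed.

End StretchedForests.

(** * From sets of edges to monomials *)

Section SquarefreeMonomials.
Variables (K : fieldType) (V : finType).
Implicit Types (a b c E : {set V}).

Definition set_multinom E : 'X_{1..#|V|} :=
  [multinom (enum_val i \in E : nat) | i < #|V|].

Definition set_monomial E : vertex_ring K V := 'X_[set_multinom E].

Lemma set_monomial_inj : injective set_monomial.
Proof.
move=> a b ab; have : set_multinom b \in msupp (set_monomial a).
  by rewrite ab msuppX mem_head.
rewrite msuppX inE => /eqP /mnmP ba; apply/setP => v.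
have := ba (enum_rank v); rewrite !mnmE enum_rankK.
by case: (v \in a); case: (v \in b).
Qed.

Lemma set_monomial_neq0 E : set_monomial E != 0.
Proof. by rewrite -msupp_eq0 msuppX. Qed.

Lemma set_monomial2 u v : u != v ->
  set_monomial [set u; v] = vertex_var K u * vertex_var K v.
Proof.
move=> uv; rewrite -mpolyXD; congr ('X_[_]); apply/mnmP => i.
rewrite mnmE mnmDE !mnm1E !inE -(enum_valK i) !(inj_eq enum_rank_inj)
  enum_rankK.
rewrite ![_ == enum_val i]eq_sym.
by have [->|] := eqVneq; rewrite ?(negPf uv).
Qed.

Lemma set_monomial_divides a b c :
  c \subset a :|: b -> divides (set_monomial c) (set_monomial a * set_monomial
    b).
Proof.
move=> /subsetP cab; rewrite -mpolyXD.
exists 'X_[set_multinom a + set_multinom b - set_multinom c].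
rewrite -mpolyXD submK //; apply/mnm_lepP => i; rewrite mnmDE !mnmE.
have := cab (enum_val i); rewrite inE.
by case: (_ \in c) => // /(_ isT) /orP[]->; rewrite ?addn1.
Qed.

End SquarefreeMonomials.

Section ChainToSystem.
Variables (V : finType).
Local Notation entry := ({set V} * option {set V})%type.
Implicit Types (l : seq entry).
Let d0 : entry := (set0, None).

(** The list is reversed, so that positions become indices of the system. *)
Lemma tree_chain_nth l i b : tree_chain l -> (i < size l)%N ->
  (nth d0 (rev l) i).2 = Some b ->
  exists2 j, (j < i)%N &
    (nth d0 (rev l) j).1 \subset (nth d0 (rev l) i).1 :|: b.
Proof.
elim: l => [|[a ob] l IH] //= /andP[hb tl]; rewrite ltnS rev_cons => il.
rewrite nth_rcons size_rev; move: il; rewrite leq_eqVlt => /orP[/eqP->|il].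
  rewrite ltnn eqxx /= => obE; move: hb; rewrite obE -has_rev.
  case/(has_nthP d0) => j; rewrite size_rev => jl sub.
  by exists j; rewrite // nth_rcons size_rev jl.
rewrite il => /(IH tl il)[j ji sub]; exists j => //.
by rewrite nth_rcons size_rev (ltn_trans ji il).
Qed.

Lemma uniq_edges_of_nth l i j E : uniq (edges_of l) ->
  (i < size l)%N -> (j < size l)%N ->
  E \in (nth d0 l i).1 :: seq_of_opt (nth d0 l i).2 ->
  E \in (nth d0 l j).1 :: seq_of_opt (nth d0 l j).2 -> i = j.
Proof.
have cross l' k F : (k < size l')%N ->
    F \in (nth d0 l' k).1 :: seq_of_opt (nth d0 l' k).2 -> F \in edges_of l'.
  move=> kl Fk; apply/flatten_mapP; exists (nth d0 l' k) => //; exact: mem_nth.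
elim: l i j => [|x l IH] [|i] [|j] //; rewrite -cat1s edges_of_cat cat_uniq.
- case/and3P=> _ /hasPn dis _ _ jl Ei Ej; have := dis _ (cross l j E jl Ej).
  by rewrite /edges_of /= cats0 Ei.
- case/and3P=> _ /hasPn dis _ il _ Ei Ej; have := dis _ (cross l i E il Ei).
  by rewrite /edges_of /= cats0 Ej.
- by case/and3P=> _ _ ul il jl Ei Ej; rewrite (IH i j).
Qed.

Lemma uniq_entry l y : uniq (edges_of l) -> y \in l ->
  uniq (y.1 :: seq_of_opt y.2).
Proof.
move=> ul yl; case/splitPr: yl ul => p1 p2.
rewrite -cat1s !edges_of_cat !cat_uniq => /and3P[_ _ /and3P[+ _ _]].
by rewrite /edges_of /= andbT.
Qed.

Lemma perm_edges_of l1 l2 :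
  perm_eq l1 l2 -> perm_eq (edges_of l1) (edges_of l2).
Proof. by move=> pl; apply: perm_flatten; apply: perm_map. Qed.

Variables (K : fieldType) (e : rel V).
Hypotheses (e_irr : irreflexive e).
Local Notation mono := (@set_monomial K V).

Lemma edge_monomialP (f : vertex_ring K V) : edge_monomial e f <->
  exists2 E, is_edge e [set: V] E & f = mono E.
Proof.
split=> [[u [v [uv ->]]]|[_ [u [v [_ _ uv ->]]] ->]].
  exists [set u; v]; first by exists u, v; rewrite !inE.
  by rewrite set_monomial2 // (e_neq e_irr).
by exists u, v; rewrite set_monomial2 // (e_neq e_irr).
Qed.

Lemma chain_tree_like_system l A r : chain_of e [set: V] l A -> size l = r.+1 ->
  exists (q a : 'I_r.+1 -> vertex_ring K V) (b : 'I_r -> vertex_ring K V),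
    tree_like_system q a b /\
    forall f, tree_like_support a b f <-> edge_monomial e f.
Proof.
move=> [tl ul lE _ _] sl; pose L := rev l.
have sL : size L = r.+1 by rewrite size_rev.
have pL : perm_eq L l by rewrite perm_rev.
have uL : uniq (edges_of L) by rewrite (perm_uniq (perm_edges_of pL)).
have LE E : E \in edges_of L <-> is_edge e [set: V] E.
  by rewrite (perm_mem (perm_edges_of pL)).
pose x (i : 'I_r.+1) := nth d0 L i.
have xinj i j E : E \in (x i).1 :: seq_of_opt (x i).2 ->
    E \in (x j).1 :: seq_of_opt (x j).2 -> i = j.
  move=> Ei Ej; apply: val_inj.
  by apply: (uniq_edges_of_nth uL _ _ Ei Ej); rewrite sL.
have ux i : uniq ((x i).1 :: seq_of_opt (x i).2).
  by apply: uniq_entry uL _; apply: mem_nth; rewrite sL.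
pose a i := mono (x i).1.
pose b (i : 'I_r) := oapp mono 0 (x (lift ord0 i)).2.
pose q i := oapp (fun j => a i + b j) (a i) (unlift ord0 i).
have bE i : b i != 0 -> exists2 E, (x (lift ord0 i)).2 = Some E & b i = mono E.
  rewrite /b; case: (x _).2 => [E _|] /=; [by exists E | by rewrite eqxx].
have x0 : (x ord0).2 = None.
  case x0E : (x ord0).2 => [E|] //.
  have [|j] := tree_chain_nth tl _ x0E; first by rewrite sl.
  by rewrite ltn0.
exists q, a, b; split; first split.
- split=> [i|i j /set_monomial_inj aij]; first exact: set_monomial_neq0.
  by apply: (xinj _ _ (x i).1); rewrite ?aij mem_head.
- move=> i j bi bij; have [E Ei bEi] := bE i bi.
  have [F Fj bFj] : exists2 E, (x (lift ord0 j)).2 = Some E & b j = mono E.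
    by apply: bE; rewrite -bij.
  have EF : E = F by apply: (@set_monomial_inj K); rewrite -bEi -bFj.
  apply: (@lift_inj _ ord0); apply: (xinj _ _ E).
    by rewrite Ei /= !inE eqxx orbT.
  by rewrite Fj /= -EF !inE eqxx orbT.
- move=> i j /bE[E Ei ->]; apply/eqP => /set_monomial_inj EF.
  have EE : E \in (x (lift ord0 i)).1 :: seq_of_opt (x (lift ord0 i)).2.
    by rewrite Ei !inE eqxx orbT.
  have ij : lift ord0 i = j by apply: (xinj _ _ E) => //; rewrite EF mem_head.
  have := ux j; rewrite -ij Ei /= !inE ij -EF eqxx //.
- split=> [|i]; first by rewrite /q unlift_none.
  by rewrite /q liftK.
- move=> i; rewrite /b; case xi : (x (lift ord0 i)).2 => [E|] /=.
    have [|j ji sub] := tree_chain_nth tl _ xi; first by rewrite sl ltn_ord.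
    exists (Ordinal (ltn_trans ji (ltn_ord _))); split=> //.
    exact: set_monomial_divides.
  by exists ord0; split=> //; exists 0; rewrite mulr0 mul0r.
move=> f; rewrite edge_monomialP; split.
  case=> [[i ->]|[i [/bE[E Ei ->] ->]]].
    exists (x i).1 => //; apply/LE/flatten_mapP; exists (x i);
      last exact: mem_head.
    by apply: mem_nth; rewrite sL.
  exists E => //; apply/LE/flatten_mapP; exists (x (lift ord0 i)).
    by apply: mem_nth; rewrite sL.
  by rewrite Ei !inE eqxx orbT.
case=> E /LE/flatten_mapP[y /(nthP d0)[k kL <-]] + ->.
rewrite sL in kL; rewrite -[k]/(val (Ordinal kL)) -/(x _) inE.
move=> /orP[/eqP->|]; first by left; exists (Ordinal kL).
case: (unliftP ord0 (Ordinal kL)) => [j|] ->; last by rewrite x0.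
case xj : (x (lift ord0 j)).2 => [F|] //=; rewrite inE => /eqP EF.
right; exists j; rewrite /b xj /= EF; split=> //; exact: set_monomial_neq0.
Qed.

End ChainToSystem.

Theorem theorem1 (K : fieldType) (V : finType) (e : rel V)
    (e_sym : ssrbool.symmetric e) (e_irr : irreflexive e)
    (e_forest : forest e) (e_stretched : stretched e)
    (e_edge : exists u v : V, e u v) :
  exists t : nat,
    [/\ is_pd (edge_ideal (K := K) e) t,
        is_ara (edge_ideal (K := K) e) t
      & exists (r : nat) (q a : 'I_r.+1 -> vertex_ring K V)
               (b : 'I_r -> vertex_ring K V),
          [/\ tree_like_system q a b,
              r.+1 = t
            & forall f : vertex_ring K V,
                tree_like_support a b f <-> edge_monomial e f]].
Proof.
have [l [A chA]] := stretched_forest_chain e_sym e_irr e_forest e_stretched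
  [set: V].
have [_ _ lE mA sA] := chA.
have [u [v uv]] := e_edge.
have [r sl] : exists r, size l = r.+1.
  have : [set u; v] \in edges_of l by apply/lE; exists u, v; rewrite !inE.
  by case: (l) => // y l' _; exists (size l').
have [q [a [b [sys supp]]]] := chain_tree_like_system K e_irr chA sl.
have gen := tree_like_radical sys supp.
have [p [resp [B mB pB] Bp]] := forest_resolution e_sym e_irr e_forest K [set:
  V].
have pr : p = r.+1.
  apply/eqP; rewrite eqn_leq -{2}sl sA Bp // andbT (leq_trans pB) //.
  by rewrite setTD; apply: cover_le_generators mB _ _ gen.
exists r.+1; split.
- rewrite -pr; apply: has_resolution_is_pd resp; first exact: upset_edge_in.
  exact: edge_idealP.
- split; first by exists q.
  by move=> s g gg; rewrite -sl sA setTD; apply: cover_le_generators mA _ _ gg.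
- by exists r, q, a, b; split.
Qed.
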